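(* Consider AWET instances whose jobs are indexed so that $r_1<\cdots<r_n$ and $s_1>\cdots>s_n$. Put $$W_E=\sum_{i=1}^n w_i^E,\qquad P=\sum_{i=1}^n p_i .$$ Then the optimal value of AWET can be computed exactly in $$O\bigl(n(W_E+1)(P+1)\bigr)$$ arithmetic operations and $O\bigl((W_E+1)(P+1)\bigr)$ (rolling) memory. Moreover, an optimal early set and canonical schedule can be recovered by storing one predecessor per reachable state, using $O\bigl(n(W_E+1)(P+1)\bigr)$ memory, or by a standard recomputation scheme.
   Context: An instance of AWET consists of jobs $J=\{1,\dots,n\}$; job $j$ has a positive integer processing time $p_j$, a positive integer earliness weight $w_j^E$, and a positive integer tardiness weight $w_j^L$. The jobs are processed nonpreemptively on one machine available from time $0$: a schedule assigns each job a real start time $S_j\ge 0$ so that the intervals $[S_j,S_j+p_j)$ are pairwise disjoint; $C_j=S_j+p_j$. The common due date is $d=\sum_{j\in J}p_j$. The cost to be minimized is $\sum_{j\in J}\bigl(w_j^E (d-C_j)^+ + w_j^L (C_j-d)^+\bigr)$ with $x^+=\max\{x,0\}$. Put $r_j=w_j^E/p_j$ and $s_j=w_j^L/p_j$. For a nonempty early set $E\subseteq J$ with $T=J\setminus E$, the canonical schedule of $E$ has no idle time between jobs, processes $E$ in nondecreasing order of $r_j$ so that the last job of $E$ completes at $d$, and then processes $T$ in nonincreasing order of $s_j$ starting at $d$; $E$ is an optimal early set if this schedule has minimum cost. The dynamic program processes jobs in index order; its states after jobs $1,\dots,j$ are pairs (sum of $w_i^E$ over jobs $i\le j$ put early, sum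 of $p_i$ over jobs $i\le j$ put tardy), each storing a least accumulated cost. Memory counts stored numbers. *)

(* Defs.v *)
From HB Require Import structures.
From mathcomp Require Import all_boot all_order all_algebra.
From mathcomp Require Import reals.

Set Implicit Arguments.
Unset Strict Implicit.
Unset Printing Implicit Defensive.

Import Order.TTheory GRing.Theory Num.Theory.

(** * The scheduling problem *)

(* Job j of the text (1 <= j <= n) is the ordinal of value j - 1. *)
Record awet (n : nat) := Awet {
  ptime : 'I_n -> nat;
  wearly : 'I_n -> nat;
  wlate : 'I_n -> nat;
  ptime_gt0 : forall j, 0 < ptime j;
  wearly_gt0 : forall j, 0 < wearly j;
  wlate_gt0 : forall j, 0 < wlate j }.

Section Scheduling.
Variables (n : nat) (I : awet n).

Definition total_ptime : nat := \sum_(j < n) ptime I j.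
Definition total_wearly : nat := \sum_(j < n) wearly I j.
Definition due_date : nat := total_ptime.

Definition early_ratio (j : 'I_n) : rat := ((wearly I j)%:R / (ptime I j)%:R)%R.
Definition late_ratio (j : 'I_n) : rat := ((wlate I j)%:R / (ptime I j)%:R)%R.

Definition strictly_indexed : Prop :=
  forall i j : 'I_n, i < j ->
    (early_ratio i < early_ratio j)%R /\ (late_ratio j < late_ratio i)%R.

Section RealSchedules.
Local Open Scope ring_scope.
Variable R : realType.
Implicit Type S : 'I_n -> R.

Definition completion S (j : 'I_n) : R := S j + (ptime I j)%:R.

Definition feasible S : Prop :=
  (forall j, 0 <= S j) /\
  (forall i j, i != j -> forall t : R,
     t \in `[S i, completion S i[ -> t \notin `[S j, completion S j[).

Definition cost S : R :=
  \sum_(j < n) ((wearly I j)%:R * Num.max (due_date%:R - completion S j) 0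
              + (wlate I j)%:R * Num.max (completion S j - due_date%:R) 0).

Definition optimal_schedule S : Prop :=
  feasible S /\ forall S', feasible S' -> cost S <= cost S'.

Definition optimal_value (v : R) : Prop :=
  exists S, optimal_schedule S /\ cost S = v.

End RealSchedules.

(* Ties in the ratios, if any, are broken by index, [sort] being stable. *)
Definition canon_seq (E : {set 'I_n}) : seq 'I_n :=
  sort (fun i j => (early_ratio i <= early_ratio j)%R) (enum E) ++
  sort (fun i j => (late_ratio j <= late_ratio i)%R) (enum (~: E)).

(* The subtraction is never truncated: the sum over E is at most due_date. *)
Definition canon_start (E : {set 'I_n}) (j : 'I_n) : nat :=
  (due_date - \sum_(i in E) ptime I i)
  + \sum_(i <- take (index j (canon_seq E)) (canon_seq E)) ptime I i.

Definition canon_schedule (R : realType) (E : {set 'I_n}) : 'I_n -> R :=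
  fun j => ((canon_start E j)%:R)%R.

Definition optimal_early_set (R : realType) (E : {set 'I_n}) : Prop :=
  E != set0 /\ optimal_schedule (@canon_schedule R E).

(** * The states of the dynamic program *)

(* A state is (sum of earliness weights of the jobs put early, sum of
   processing times of the jobs put tardy).  Putting job j early makes every
   early job of smaller index complete p_j sooner, at a cost of p_j times the
   first component; put tardy, j completes at the due date plus the updated
   second component. *)
Definition dp_move (j : 'I_n) (early : bool) (s : nat * nat) : nat * nat :=
  if early then (s.1 + wearly I j, s.2) else (s.1, s.2 + ptime I j).

Definition dp_cost (j : 'I_n) (early : bool) (s : nat * nat) : nat :=
  if early then ptime I j * s.1 else wlate I j * (s.2 + ptime I j).

Definition state_after (k : nat) (E : {set 'I_n}) : nat * nat :=
  (\sum_(i < n | (i < k) && (i \in E)) wearly I i,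
   \sum_(i < n | (i < k) && (i \notin E)) ptime I i).

Definition state_cost (k : nat) (E : {set 'I_n}) : nat :=
  \sum_(i < n | i < k) dp_cost i (i \in E) (state_after i E).

Definition reachable (k : nat) (s : nat * nat) : Prop :=
  exists E, state_after k E = s.

Definition least_cost (k : nat) (s : nat * nat) (c : nat) : Prop :=
  (exists E, state_after k E = s /\ state_cost k E = c) /\
  (forall E, state_after k E = s -> c <= state_cost k E).

(* The decision for job j determines the state before job j from the state s
   after it, so that this decision is what is stored as the predecessor. *)
Definition is_predecessor (j : 'I_n) (s : nat * nat) (early : bool) : Prop :=
  exists s' c, [/\ s = dp_move j early s', least_cost j s' c
                 & least_cost j.+1 s (c + dp_cost j early s')].

End Scheduling.

(** * The machine model *)

(* A unit-cost random access machine on natural numbers with finitely many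
   registers and an array memory, programmed by structured commands.  There is
   no division.  Every node of an evaluated expression, every assignment, every
   store and every test costs one operation, which bounds in particular the
   number of arithmetic operations. *)

Inductive binop := OAdd | OSub | OMul | OLeq.

Inductive expr :=
  | EConst of nat
  | EReg of nat
  | ELoad of expr
  | EOp of binop & expr & expr.

Inductive cmd :=
  | CSkip
  | CAssign of nat & expr
  | CStore of expr & expr
  | CSeq of cmd & cmd
  | CIf of expr & cmd & cmd
  | CWhile of expr & cmd.

Record state := State { reg : nat -> nat; mem : nat -> nat }.

Definition set_reg (x v : nat) (st : state) : state :=
  State (fun y => if y == x then v else reg st y) (mem st).

Definition set_mem (a v : nat) (st : state) : state :=
  State (reg st) (fun b => if b == a then v else mem st b).

(* Subtraction is truncated at 0. *)
Definition eval_op (o : binop) (x y : nat) : nat :=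
  match o with
  | OAdd => x + y
  | OSub => x - y
  | OMul => x * y
  | OLeq => (x <= y : bool)
  end.

Fixpoint eval (e : expr) (st : state) : nat :=
  match e with
  | EConst v => v
  | EReg x => reg st x
  | ELoad a => mem st (eval a st)
  | EOp o e1 e2 => eval_op o (eval e1 st) (eval e2 st)
  end.

Fixpoint expr_time (e : expr) : nat :=
  match e with
  | EConst _ | EReg _ => 1
  | ELoad a => (expr_time a).+1
  | EOp _ e1 e2 => (expr_time e1 + expr_time e2).+1
  end.

(* Space is the least m such that every address read or written is below m;
   it therefore includes the input and dominates the number of cells used. *)
Fixpoint expr_space (e : expr) (st : state) : nat :=
  match e with
  | EConst _ | EReg _ => 0
  | ELoad a => maxn (expr_space a st) (eval a st).+1
  | EOp _ e1 e2 => maxn (expr_space e1 st) (expr_space e2 st)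
  end.

(* [exec c st st' t m]: from st, command c halts in st' after t operations,
   within the memory cells of address below m.  Tests succeed on nonzero
   values. *)
Inductive exec : cmd -> state -> state -> nat -> nat -> Prop :=
  | ExecSkip st : exec CSkip st st 0 0
  | ExecAssign x e st :
      exec (CAssign x e) st (set_reg x (eval e st) st)
           (expr_time e).+1 (expr_space e st)
  | ExecStore a e st :
      exec (CStore a e) st (set_mem (eval a st) (eval e st) st)
           (expr_time a + expr_time e).+1
           (maxn (eval a st).+1 (maxn (expr_space a st) (expr_space e st)))
  | ExecSeq c1 c2 st1 st2 st3 t1 t2 m1 m2 :
      exec c1 st1 st2 t1 m1 -> exec c2 st2 st3 t2 m2 ->
      exec (CSeq c1 c2) st1 st3 (t1 + t2) (maxn m1 m2)
  | ExecIf e c1 c2 st st' t m :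
      exec (if eval e st != 0 then c1 else c2) st st' t m ->
      exec (CIf e c1 c2) st st' ((expr_time e).+1 + t)
           (maxn (expr_space e st) m)
  | ExecWhileEnd e c st :
      eval e st = 0 ->
      exec (CWhile e c) st st (expr_time e).+1 (expr_space e st)
  | ExecWhileStep e c st1 st2 st3 t1 t2 m1 m2 :
      eval e st1 != 0 ->
      exec c st1 st2 t1 m1 -> exec (CWhile e c) st2 st3 t2 m2 ->
      exec (CWhile e c) st1 st3 ((expr_time e).+1 + t1 + t2)
           (maxn (expr_space e st1) (maxn m1 m2)).

(* The number of registers of a program (1 + the largest one it mentions). *)
Fixpoint expr_regs (e : expr) : nat :=
  match e with
  | EConst _ => 0
  | EReg x => x.+1
  | ELoad a => expr_regs a
  | EOp _ e1 e2 => maxn (expr_regs e1) (expr_regs e2)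
  end.

Fixpoint cmd_regs (c : cmd) : nat :=
  match c with
  | CSkip => 0
  | CAssign x e => maxn x.+1 (expr_regs e)
  | CStore a e => maxn (expr_regs a) (expr_regs e)
  | CSeq c1 c2 => maxn (cmd_regs c1) (cmd_regs c2)
  | CIf e c1 c2 => maxn (expr_regs e) (maxn (cmd_regs c1) (cmd_regs c2))
  | CWhile e c => maxn (expr_regs e) (cmd_regs c)
  end.

(** * Solving AWET on the machine *)

Section Solving.
Variables (n : nat) (I : awet n).

(* The input n, p_1 .. p_n, w^E_1 .. w^E_n, w^L_1 .. w^L_n occupies the cells
   0 .. 3n; all other cells and all registers are initially 0. *)
Definition input_seq : seq nat :=
  n :: [seq ptime I j | j : 'I_n] ++ [seq wearly I j | j : 'I_n]
    ++ [seq wlate I j | j : 'I_n].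

Definition init_state : state := State (fun _ => 0) (nth 0 input_seq).

Definition runs_within (c : cmd) (T M : nat) (Q : state -> nat -> Prop) : Prop :=
  exists (f : state) (t m : nat),
    [/\ exec c init_state f t m, t <= T, cmd_regs c + m <= M & Q f m].

Definition table_size : nat := (total_wearly I).+1 * (total_ptime I).+1.

(* On halting, register 0 points to n cells holding the indicator of E followed
   by n cells holding the start times of its canonical schedule. *)
Definition outputs_early_set (E : {set 'I_n}) (f : state) (m : nat) : Prop :=
  reg f 0 + 2 * n <= m /\
  forall j : 'I_n, mem f (reg f 0 + j) = (j \in E) :> nat /\
                   mem f (reg f 0 + n + j) = canon_start I E j.

(* The halting memory holds, at the address [addr j s], a predecessor of each
   state s reachable after job j, distinct states having distinct cells, and E
   is read off this table by tracing back: [state_after I n E] is the terminal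
   state and the entry of [state_after I j.+1 E] decides whether j is early. *)
Definition traced_from_predecessors (addr : nat -> nat * nat -> nat)
    (E : {set 'I_n}) (f : state) (m : nat) : Prop :=
  [/\ forall (j : 'I_n) s, reachable I j.+1 s ->
        addr j s < m /\
        exists2 early : bool, mem f (addr j s) = early :> nat
                            & is_predecessor I j s early,
      forall (i j : 'I_n) s s', reachable I i.+1 s -> reachable I j.+1 s' ->
        addr i s = addr j s' -> i = j /\ s = s'
    & forall j : 'I_n,
        mem f (addr j (state_after I j.+1 E)) = (j \in E) :> nat].

End Solving.

(* Main.v *)
Require Import Defs.
From HB Require Import structures.
From mathcomp Require Import all_boot all_order all_algebra.
From mathcomp Require Import reals.
From mathcomp Require Import zify ring lra.

Set Implicit Arguments.
Unset Strict Implicit.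
Unset Printing Implicit Defensive.

(* Fix the early set E of a schedule in which no job crosses the due date d.  The
   earliness of j is at least the total length of the early jobs after j, its
   tardiness at least its own length plus that of the tardy jobs before it.  The
   resulting bound is a sum over pairs of jobs, and the strict order of the
   ratios makes index order optimal for every pair at once; this yields the cost
   accumulated by the dynamic program along E, which the canonical schedule of E
   attains.  If a job k crosses d, moving the whole schedule so that k ends or
   starts at d lets no other job cross d meanwhile; the cost is affine in the
   displacement, so one of the two moves does not increase it.

   The table is updated in place, one job after the other, together with one
   decision bit per cell.  The bits of job j start at a stride times j: with a
   stride of one table they all survive, with stride 0 only those of the last
   processed job do and the trace repeats the forward pass for every job. *)

Import Order.TTheory GRing.Theory Num.Theory.

(* [ssrbool] would otherwise hide the memory of a machine state. *)
Local Notation mem := Defs.mem.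

(** * Rules for the machine *)

Definition runs (c : cmd) (st : state) (T M : nat) (Q : state -> Prop) : Prop :=
  exists st' t m, [/\ exec c st st' t m, t <= T, m <= M & Q st'].

Lemma runs_weaken c st T T' M (Q Q' : state -> Prop) :
  T <= T' -> (forall st', Q st' -> Q' st') ->
  runs c st T M Q -> runs c st T' M Q'.
Proof.
move=> leT QQ' [st' [t [m [ex le_t le_m q]]]]; exists st', t, m; split=> //.
- exact: leq_trans leT.
- exact: QQ'.
Qed.

Lemma runs_seq c1 c2 st T1 T2 M Q :
  runs c1 st T1 M (fun st' => runs c2 st' T2 M Q) ->
  runs (CSeq c1 c2) st (T1 + T2) M Q.
Proof.
move=> [st1 [t1 [m1 [ex1 le_t1 le_m1 [st2 [t2 [m2 [ex2 le_t2 le_m2 q]]]]]]]].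
exists st2, (t1 + t2), (maxn m1 m2); split=> //; first exact: ExecSeq ex1 ex2.
- exact: leq_add.
- by rewrite geq_max le_m1.
Qed.

Fixpoint writes (c : cmd) : seq nat :=
  match c with
  | CSkip | CStore _ _ => [::]
  | CAssign x _ => [:: x]
  | CSeq c1 c2 | CIf _ c1 c2 => writes c1 ++ writes c2
  | CWhile _ c => writes c
  end.

Definition keeps (c : cmd) (st st' : state) : Prop :=
  forall x, x \notin writes c -> reg st' x = reg st x.

Lemma exec_keeps c st st' t m : exec c st st' t m -> keeps c st st'.
Proof.
elim=> {c st st' t m} //=.
- by move=> x e st y /=; rewrite inE => /negPf /= ->.
- move=> c1 c2 st1 st2 st3 t1 t2 m1 m2 _ IH1 _ IH2 x /=.
  by rewrite mem_cat negb_or => /andP[x1 x2]; rewrite IH2 // IH1.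
- move=> e c1 c2 st st' t m _ IH x /=.
  by rewrite mem_cat negb_or => /andP[x1 x2]; apply: IH; case: ifP.
- move=> e c st1 st2 st3 t1 t2 m1 m2 _ _ IH1 _ IH2 x /= xc.
  by rewrite IH2 // IH1.
Qed.

(** This frame rule recovers the registers outside [writes c], so loop invariants need not carry
    them. *)
Lemma runs_keeps c st T M Q :
  runs c st T M Q -> runs c st T M (fun st' => Q st' /\ keeps c st st').
Proof.
move=> [st' [t [m [ex le_t le_m q]]]]; exists st', t, m; split=> //.
by split=> //; apply: exec_keeps ex.
Qed.

(** [Inv i] describes the state after [i] rounds, and the guard fails exactly at round [N]. Counting
    [N.+1] full rounds also pays for the final failing test. *)
Lemma runs_while e c st N T M (Inv : nat -> state -> Prop) :
  (forall i st1, i < N -> Inv i st1 ->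
     [/\ eval e st1 != 0, expr_space e st1 <= M & runs c st1 T M (Inv i.+1)]) ->
  (forall st1, Inv N st1 -> eval e st1 = 0 /\ expr_space e st1 <= M) ->
  Inv 0 st ->
  runs (CWhile e c) st (N.+1 * ((expr_time e).+1 + T)) M (Inv N).
Proof.
move=> step stop; rewrite -[N in N.+1]subn0.
have: 0 <= N by []; move: 0 st => i st.
(* Induction on the number of remaining rounds, with the round [i] generalized. *)
have [d] := ubnP (N - i); elim: d i st => // d IH i st ltd leiN inv.
move: leiN; rewrite leq_eqVlt => /predU1P[iN | ltiN].
  subst i; have [e0 sp] := stop _ inv.
  exists st, (expr_time e).+1, (expr_space e st); split=> //.
    exact: ExecWhileEnd.
  by rewrite subnn mul1n leq_addr.
have [e1 sp [st1 [t1 [m1 [ex1 le_t1 le_m1 inv1]]]]] := step _ _ ltiN inv.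
have ltd1 : N - i.+1 < d by lia.
have [st2 [t2 [m2 [ex2 le_t2 le_m2 inv2]]]] := IH _ _ ltd1 ltiN inv1.
exists st2, ((expr_time e).+1 + t1 + t2), (maxn (expr_space e st) (maxn m1 m2)).
split=> //; first exact: ExecWhileStep ex1 ex2.
- have -> : (N - i).+1 = (N - i.+1).+2 by lia.
  rewrite mulSn; apply: leq_add => //.
  by rewrite leq_add2l.
- by rewrite !geq_max sp le_m1.
Qed.

(** Meant for loop-free code; loops go through [runs_while]. Computed values are bound by equations,
    so that a proof may keep them as variables and replace the equation by a more useful one. *)
Fixpoint wp (M : nat) (c : cmd) (st : state) (Q : state -> Prop) : Prop :=
  match c with
  | CSkip => Q st
  | CAssign x e =>
      expr_space e st <= M /\
      forall v, v = eval e st -> Q (set_reg x v st)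
  | CStore a e =>
      [/\ expr_space a st <= M, expr_space e st <= M, eval a st < M &
          forall i v, i = eval a st -> v = eval e st -> Q (set_mem i v st)]
  | CSeq c1 c2 => wp M c1 st (fun st' => wp M c2 st' Q)
  | CIf e c1 c2 =>
      expr_space e st <= M /\
      if eval e st != 0 then wp M c1 st Q else wp M c2 st Q
  | CWhile _ _ => False
  end.

Fixpoint line_time (c : cmd) : nat :=
  match c with
  | CSkip | CWhile _ _ => 0
  | CAssign _ e => (expr_time e).+1
  | CStore a e => (expr_time a + expr_time e).+1
  | CSeq c1 c2 => line_time c1 + line_time c2
  | CIf e c1 c2 => (expr_time e).+1 + maxn (line_time c1) (line_time c2)
  end.

Lemma runs_wp M c st Q : wp M c st Q -> runs c st (line_time c) M Q.
Proof.
elim: c st Q => /=.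
- by move=> st Q q; exists st, 0, 0; split=> //; apply: ExecSkip.
- move=> x e st Q [sp q].
  by eexists; eexists; eexists; split;
    [exact: ExecAssign | exact: leqnn | exact: sp | exact: q].
- move=> a e st Q [spa spe lta q].
  eexists; eexists; eexists; split;
    [exact: ExecStore | exact: leqnn | by rewrite !geq_max lta spa | exact: q].
- move=> c1 IH1 c2 IH2 st Q /IH1 r1; apply: runs_seq.
  by apply: runs_weaken r1 => // st' /IH2.
- move=> e c1 IH1 c2 IH2 st Q [sp q].
  have [st' [t [m [ex le_t le_m q']]]] :
    runs (if eval e st != 0 then c1 else c2) st
         (maxn (line_time c1) (line_time c2)) M Q.
    by case: ifP q => _; [move=> /IH1 | move=> /IH2]; apply: runs_weaken => //;
      rewrite ?leq_maxl ?leq_maxr.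
  exists st', ((expr_time e).+1 + t), (maxn (expr_space e st) m); split=> //.
  + exact: ExecIf ex.
  + by rewrite leq_add2l.
  + by rewrite geq_max sp.
- by [].
Qed.

(** * The programs *)

Declare Scope ram_scope.
Delimit Scope ram_scope with ram.
Bind Scope ram_scope with expr.
Bind Scope ram_scope with cmd.
Local Notation "$ x" := (EReg x) (at level 1, x at level 0, format "$ x") : ram_scope.
Local Notation "` v" := (EConst v) (at level 1, v at level 0, format "` v") : ram_scope.
Local Notation "@[ a ]" := (ELoad a) (at level 0, format "@[ a ]") : ram_scope.
Local Notation "a + b" := (EOp OAdd a b) : ram_scope.
Local Notation "a - b" := (EOp OSub a b) : ram_scope.
Local Notation "a * b" := (EOp OMul a b) : ram_scope.
Local Notation "a <= b" := (EOp OLeq a b) : ram_scope.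
Local Notation "x ::= e" := (CAssign x e) (at level 76, e at level 75) : ram_scope.
Local Notation "a ::~ e" := (CStore a e) (at level 76, e at level 75) : ram_scope.
Local Notation "c ;; d" := (CSeq c d) (at level 80, right associativity) : ram_scope.

(* rTab and rBit are the addresses of the table and of the decision bits, rStr is
   the distance between the bits of consecutive jobs and rRow the address of the
   bits of the current job; a forward pass handles the first rLim jobs.  The scan
   visits the pair (rA, rB), stored in cell rI.  During the trace rCur and rTardy
   are the cell and the second component of the current state, rLast is the
   second component of the terminal state and rPre the sum of p_i over i < rJ. *)
Local Notation rOut := 0 (only parsing).
Local Notation rN := 1 (only parsing).
Local Notation rW := 2 (only parsing).
Local Notation rP := 3 (only parsing).
Local Notation rQ := 4 (only parsing).
Local Notation rT := 5 (only parsing).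
Local Notation rTab := 6 (only parsing).
Local Notation rBit := 7 (only parsing).
Local Notation rStr := 8 (only parsing).
Local Notation rLim := 9 (only parsing).
Local Notation rK := 10 (only parsing).
Local Notation rI := 11 (only parsing).
Local Notation rA := 12 (only parsing).
Local Notation rB := 13 (only parsing).
Local Notation rp := 14 (only parsing).
Local Notation re := 15 (only parsing).
Local Notation rl := 16 (only parsing).
Local Notation rX := 17 (only parsing).
Local Notation rY := 18 (only parsing).
Local Notation rRow := 19 (only parsing).
Local Notation rV := 20 (only parsing).
Local Notation rCur := 21 (only parsing).
Local Notation rTardy := 22 (only parsing).
Local Notation rLast := 23 (only parsing).
Local Notation rJ := 24 (only parsing).
Local Notation rPre := 25 (only parsing).
Local Notation rD := 26 (only parsing).

Definition sum_body : cmd := (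
  rP ::= $rP + @[`1 + $rK] ;;
  rW ::= $rW + @[`1 + $rN + $rK] ;;
  rK ::= $rK + `1)%ram.

Definition setup (full : bool) : cmd := (
  rQ ::= $rP + `1 ;;
  rT ::= ($rW + `1) * $rQ ;;
  rOut ::= `3 * $rN + `1 ;;
  rTab ::= `5 * $rN + `1 ;;
  rBit ::= $rTab + $rT ;;
  rStr ::= `full * $rT ;;
  rLim ::= $rN)%ram.

Definition prologue (full : bool) : cmd := (
  rN ::= @[`0] ;;
  CWhile ($rK + `1 <= $rN) sum_body ;;
  setup full)%ram.

Definition clear_body : cmd := (
  $rTab + $rI ::~ `0 ;;
  rI ::= $rI + `1)%ram.

Definition next_pair : cmd := (
  rI ::= $rI - `1 ;;
  rA ::= $rA - (`1 - (`1 <= $rB)) ;;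
  rB ::= (`1 - (`1 <= $rB)) * $rP + ($rB - `1))%ram.

(* Both candidates are read from cells not after the current one, which the
   decreasing scan has not updated yet.  Truncated subtraction keeps the address
   inside the table when a candidate does not exist; its value is then
   multiplied by 0. *)
Definition cell_body : cmd := (
  next_pair ;;
  rX ::= ($re <= $rA) * @[$rTab + ($rI - $re * $rQ)] ;;
  rX ::= $rX + (`1 <= $rX) * ($rp * ($rA - $re)) ;;
  rY ::= ($rp <= $rB) * @[$rTab + ($rI - $rp)] ;;
  rY ::= $rY + (`1 <= $rY) * ($rl * $rB) ;;
  rD ::= (`1 <= $rX) * (`1 - (`1 <= $rY) * (`1 - ($rX <= $rY))) ;;
  $rTab + $rI ::~ $rD * $rX + (`1 - $rD) * $rY ;;
  $rRow + $rI ::~ $rD)%ram.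

Definition start_scan : cmd := (
  rI ::= $rT ;;
  rA ::= $rW + `1 ;;
  rB ::= `0)%ram.

Definition job_head : cmd := (
  rp ::= @[`1 + $rK] ;;
  re ::= @[`1 + $rN + $rK] ;;
  rl ::= @[`1 + `2 * $rN + $rK] ;;
  rRow ::= $rBit + $rStr * $rK ;;
  start_scan)%ram.

Definition job_body : cmd := (
  job_head ;; CWhile $rI cell_body ;; rK ::= $rK + `1)%ram.

Definition forward : cmd := (
  rI ::= `0 ;;
  CWhile ($rI + `1 <= $rT) clear_body ;;
  ($rTab ::~ `1 ;; rK ::= `0) ;;
  CWhile ($rK + `1 <= $rLim) job_body)%ram.

Definition min_body : cmd := (
  next_pair ;;
  rX ::= @[$rTab + $rI] ;;
  CIf ((`1 <= $rX) * ((`1 - (`1 <= $rV)) + ($rX <= $rV)))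
    (rV ::= $rX ;; rCur ::= $rI ;; rTardy ::= $rB)
    CSkip)%ram.

Definition find_min : cmd := (
  (start_scan ;; rV ::= `0) ;; CWhile $rI min_body)%ram.

(* As d is the sum of all p_i, an early job j starts at rLast plus the sum of p_i
   over the early jobs i < j. *)
Definition trace_read : cmd := (
  rD ::= @[$rBit + $rStr * $rJ + $rCur] ;;
  rp ::= @[`1 + $rJ] ;;
  rPre ::= $rPre - $rp ;;
  $rOut + $rJ ::~ $rD ;;
  CIf $rD
    (rCur ::= $rCur - @[`1 + $rN + $rJ] * $rQ ;;
     $rOut + $rN + $rJ ::~ $rLast + ($rPre - $rTardy))
    (rCur ::= $rCur - $rp ;;
     rTardy ::= $rTardy - $rp ;;
     $rOut + $rN + $rJ ::~ $rP + $rTardy))%ram.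

Definition trace_body (full : bool) : cmd := (
  rJ ::= $rJ - `1 ;;
  (if full then CSkip else (rLim ::= $rJ + `1 ;; forward)) ;;
  trace_read)%ram.

Definition trace (full : bool) : cmd := (
  (rLast ::= $rTardy ;; rJ ::= $rN ;; rPre ::= $rP) ;;
  CWhile $rJ (trace_body full))%ram.

(* Makes the space used by a run known exactly, not only bounded. *)
Definition touch_top : cmd := (
  $rBit + $rT + $rStr * $rN ::~ `0)%ram.

Definition min_program (full : bool) : cmd := (
  prologue full ;; forward ;; find_min)%ram.

Definition value_program : cmd := (
  min_program false ;; rOut ::= $rV - `1)%ram.

Definition early_set_program (full : bool) : cmd := (
  (min_program full ;; trace full) ;; touch_top)%ram.

(** * The recurrence *)

Section Recurrence.
Variables p e l : nat -> nat.

Definition extend (ok : bool) (x c : nat) : nat :=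
  if ok && (0 < x) then x + c else 0.

(** Comparison of encoded costs in which 0 counts as infinity; ties go to the early candidate
    [x]. *)
Definition prefer (x y : nat) : bool := (0 < x) && ((y == 0) || (x <= y)).

(* 0 encodes an unreachable state and c + 1 the least cost c. *)
Fixpoint dp (k a b : nat) : nat :=
  if k is k'.+1 then
    let x := extend (e k' <= a) (dp k' (a - e k') b) (p k' * (a - e k')) in
    let y := extend (p k' <= b) (dp k' a (b - p k')) (l k' * b) in
    if prefer x y then x else y
  else ((a == 0) && (b == 0) : nat).

Definition dp_early (k a b : nat) : bool :=
  prefer (extend (e k <= a) (dp k (a - e k) b) (p k * (a - e k)))
         (extend (p k <= b) (dp k a (b - p k)) (l k * b)).

End Recurrence.

Definition sumif (f : nat -> nat) (c : nat -> bool) (k : nat) : nat :=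
  \sum_(i < k | c i) f i.

Lemma sumif0 f c : sumif f c 0 = 0.
Proof. by rewrite /sumif big_ord0. Qed.

Lemma sumifS f c k : sumif f c k.+1 = sumif f c k + (if c k then f k else 0).
Proof. by rewrite /sumif big_mkcond big_ord_recr -big_mkcond. Qed.

Lemma sumif_le f c k m : k <= m -> sumif f c k <= \sum_(i < m) f i.
Proof.
move=> lekm; apply: (@leq_trans (\sum_(i < k) f i)).
  by rewrite /sumif big_mkcond leq_sum // => i _; case: ifP.
elim: m lekm => [|m IH]; first by rewrite leqn0 => /eqP ->.
rewrite leq_eqVlt => /predU1P[-> // | /IH /leq_trans]; apply.
by rewrite big_ord_recr leq_addr.
Qed.

Lemma sumif_split f c k :
  sumif f c k + sumif f (fun i => ~~ c i) k = \sum_(i < k) f i.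
Proof. by rewrite /sumif [RHS](bigID (fun i : 'I_k => c i)). Qed.

(** * The recurrence against the costs of decision sequences *)

Section Paths.
Variables p e l : nat -> nat.

Definition path_cost (ear : nat -> bool) (k : nat) : nat :=
  \sum_(j < k) (if ear j then p j * sumif e ear j
                else l j * (sumif p (fun i => ~~ ear i) j + p j)).

Lemma prefer_bound x y m :
  0 < x <= m \/ 0 < y <= m -> 0 < (if prefer x y then x else y) <= m.
Proof.
rewrite /prefer; case: x => [|x]; case: y => [|y] /=; try lia.
by case: ifP => h; lia.
Qed.

(** The last decision of [ear] provides one of the two candidates, and the recurrence keeps a value
    no larger than any candidate that is present. *)
Lemma dp_le_path_cost ear k :
  0 < dp p e l k (sumif e ear k) (sumif p (fun i => ~~ ear i) k)
    <= (path_cost ear k).+1.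
Proof.
elim: k => [|k /andP[IH0 IH]]; first by rewrite !sumif0 /path_cost big_ord0.
rewrite /path_cost big_ord_recr /= -/(path_cost ear k) !sumifS.
case: (ear k) => /=; rewrite ?addn0 leq_addl addnK; apply: prefer_bound.
  by left; rewrite /extend IH0 /=; lia.
by right; rewrite /extend IH0 /=; lia.
Qed.

Lemma dp_step k a b : 0 < dp p e l k.+1 a b ->
  if dp_early p e l k a b
  then [/\ e k <= a, 0 < dp p e l k (a - e k) b
        & dp p e l k.+1 a b = dp p e l k (a - e k) b + p k * (a - e k)]
  else [/\ p k <= b, 0 < dp p e l k a (b - p k)
        & dp p e l k.+1 a b = dp p e l k a (b - p k) + l k * b].
Proof.
rewrite /= /dp_early; case: ifP => [/andP[] | _]; rewrite {1}/extend.
  by rewrite /extend; case: ifP => // /andP[-> ->].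
by rewrite /extend; case: ifP => // /andP[-> ->].
Qed.

(** [ear] agrees with the stored decision bits at the states that it itself visits, as a backward
    trace through the bits does. *)
Definition traces ear k : Prop := forall j, j < k ->
  dp_early p e l j (sumif e ear j.+1) (sumif p (fun i => ~~ ear i) j.+1) = ear j.

Lemma dp_trace k a b : 0 < dp p e l k a b ->
  exists ear, [/\ traces ear k, sumif e ear k = a &
                  sumif p (fun i => ~~ ear i) k = b].
Proof.
elim: k a b => [|k IH] a b.
  by case: a b => [|a] [|b] //= _; exists (fun _ => true); rewrite !sumif0; split.
move/dp_step; set d := dp_early _ _ _ _ _ _ => dE.
have [ear [tr sa sb]] : exists ear, [/\ traces ear k,
    sumif e ear k = (if d then a - e k else a) &
    sumif p (fun i => ~~ ear i) k = (if d then b else b - p k)].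
  by case: d dE => [] [_ /IH].
(* The path to the predecessor state is extended by the decision [d] at [k]; partial sums up to [k]
   do not see the change. *)
pose ear' i := if i == k then d else ear i.
have eqe j i : j <= k -> i < j -> ear' i = ear i.
  by move=> lej ltj; rewrite /ear' ltn_eqF // (leq_trans ltj).
have eqa j : j <= k -> sumif e ear' j = sumif e ear j.
  by move=> lej; apply: eq_bigl => i; apply: eqe (ltn_ord i).
have eqb j : j <= k -> sumif p (fun i => ~~ ear' i) j = sumif p (fun i => ~~ ear i) j.
  by move=> lej; apply: eq_bigl => i; rewrite (eqe j).
have earK : ear' k = d by rewrite /ear' eqxx.
have saK : sumif e ear' k.+1 = a.
  by move: dE; rewrite sumifS eqa // earK sa; case: (d) => -[le _ _]; rewrite ?addn0 ?subnK.
have sbK : sumif p (fun i => ~~ ear' i) k.+1 = b.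
  by move: dE; rewrite sumifS eqb // earK sb; case: (d) => -[le _ _]; rewrite ?addn0 ?subnK.
exists ear'; split=> // j; rewrite ltnS leq_eqVlt => /predU1P[-> | ltj].
  by rewrite saK sbK earK.
by rewrite eqa ?eqb // tr // (eqe j.+1).
Qed.

(** Along a traced path the candidate chosen by the recurrence is always the one that the path
    follows, so [dp_step] adds up the path cost exactly, starting from the code 1 of cost 0. *)
Lemma dp_eq_path_cost ear k : traces ear k ->
  dp p e l k (sumif e ear k) (sumif p (fun i => ~~ ear i) k) = (path_cost ear k).+1.
Proof.
elim: k => [|k IH] tr; first by rewrite !sumif0 /path_cost big_ord0.
have {}IH := IH (fun j ltj => tr j (ltnW ltj)).
have /andP[/dp_step + _] := dp_le_path_cost ear k.+1; rewrite tr //.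
rewrite /path_cost big_ord_recr -/(path_cost ear k) !sumifS.
by case: (ear k) => -[_ _ ->] /=; rewrite !addn0 addnK IH addSn.
Qed.

End Paths.

(** * Correctness and running time of the programs *)

Section Verification.
Variables (m0 : nat -> nat) (full : bool).

(** * Memory layout *)

Definition njobs := m0 0.
Definition in_ptime k := m0 (1 + k).
Definition in_wearly k := m0 (1 + njobs + k).
Definition in_wlate k := m0 (1 + 2 * njobs + k).
Notation opt := (dp in_ptime in_wearly in_wlate).
Notation opt_early := (dp_early in_ptime in_wearly in_wlate).

Definition sumP := \sum_(k < njobs) in_ptime k.
Definition sumE := \sum_(k < njobs) in_wearly k.
Definition table_cells := sumE.+1 * sumP.+1.
Definition stride := full * table_cells.
(** Cells 0 to 3n hold the input and the next 2n cells the output. *)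
Definition table_addr := 5 * njobs + 1.
Definition bits_addr := table_addr + table_cells.
(** With stride 0 the summand [table_cells] is the single row of bits; the successor accounts for
    the cell written by [touch_top]. *)
Definition space := (bits_addr + table_cells + stride * njobs).+1.
Definition cell a b := a * sumP.+1 + b.

Lemma cell_lt a b : a <= sumE -> b <= sumP -> cell a b < table_cells.
Proof. by rewrite /cell /table_cells => *; nia. Qed.

Lemma cell_inj a b a' b' : b <= sumP -> b' <= sumP ->
  cell a b = cell a' b' -> a = a' /\ b = b'.
Proof.
rewrite /cell => lb lb' E; have := congr1 (fun i => i %/ sumP.+1) E.
have := congr1 (fun i => i %% sumP.+1) E.
by rewrite !modnMDl !divnMDl // !divn_small ?modn_small // !addn0.
Qed.

Lemma stride_row k : k < njobs -> stride * k + table_cells <= table_cells + stride * njobs.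
Proof. by move=> lt; rewrite addnC leq_add2l leq_mul2l ltnW ?orbT. Qed.

Record base (st : state) : Prop := Base {
  baseOut : reg st rOut = 3 * njobs + 1;
  baseN : reg st rN = njobs;
  baseW : reg st rW = sumE;
  baseP : reg st rP = sumP;
  baseQ : reg st rQ = sumP.+1;
  baseT : reg st rT = table_cells;
  baseTab : reg st rTab = table_addr;
  baseBit : reg st rBit = bits_addr;
  baseStr : reg st rStr = stride;
  base_in : forall a, a <= 3 * njobs -> mem st a = m0 a }.

Definition table k (st : state) : Prop := forall a b, a <= sumE -> b <= sumP ->
  mem st (table_addr + cell a b) = opt k a b.

Definition bits k (st : state) : Prop := forall a b, a <= sumE -> b <= sumP ->
  mem st (bits_addr + stride * k + cell a b) = opt_early k a b.

(* The scan starts at the pair (sumE + 1, 0), one past the last cell. *)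
Definition scanning i st : Prop :=
  [/\ reg st rI = table_cells - i, reg st rI = cell (reg st rA) (reg st rB),
      reg st rB <= sumP & i <= table_cells].

(** [1 - (0 < b)] is the borrow of a row-major countdown: from [b = 0] the scan moves to the end of
    the previous row. The initial pair, outside the table, thus moves to the last cell. *)
Lemma next_pairP i st : i < table_cells -> scanning i st ->
  let b := reg st rB in
  [/\ reg st rI - 1 = table_cells - i.+1,
     reg st rI - 1 = cell (reg st rA - (1 - (0 < b)))
                          ((1 - (0 < b)) * sumP + (b - 1)),
     (1 - (0 < b)) * sumP + (b - 1) <= sumP
   & reg st rA - (1 - (0 < b)) <= sumE].
Proof.
move=> lti [-> E lb _] b; have cl := E; rewrite /b in lb *.
have : cell (reg st rA) (reg st rB) = table_cells - i by [].
have : 0 < table_cells - i by rewrite subn_gt0.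
have : table_cells - i <= table_cells by rewrite leq_subr.
rewrite /cell {2}/table_cells; case: (reg st rB) lb => [|b'] /= lb.
  rewrite !subn0 subn1 mul1n !addn0.
  case: (reg st rA) => [|a] h1 h2 h3; first lia.
  rewrite mulSn in h3; rewrite subn1 /=; split; [lia|lia|lia|nia].
move=> h1 h2 h3; rewrite !subn0 mul0n add0n; split; [lia|lia|lia|nia].
Qed.

(** In-place update: the cells not yet scanned belong to stage [k], the scanned ones to stage
    [k.+1]. The last clause protects the input, the output and the bit rows of earlier jobs; its
    second range is empty for stride 0. *)
Definition cell_inv k (st0 : state) i (st : state) : Prop :=
  [/\ base st, scanning i st,
      [/\ reg st rp = in_ptime k, reg st re = in_wearly k, reg st rl = in_wlate k,
          reg st rRow = bits_addr + stride * k & reg st rK = k] &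
  [/\ forall a b, a <= sumE -> b <= sumP ->
        mem st (table_addr + cell a b) =
        opt (if cell a b < table_cells - i then k else k.+1) a b,
      forall a b, a <= sumE -> b <= sumP -> table_cells - i <= cell a b ->
        mem st (bits_addr + stride * k + cell a b) = opt_early k a b
    & forall x, x < table_addr \/ bits_addr <= x < bits_addr + stride * k ->
        mem st x = mem st0 x]].

Lemma cell_step k st0 i st : k < njobs -> i < table_cells -> cell_inv k st0 i st ->
  wp space cell_body st (cell_inv k st0 i.+1).
Proof.
move=> ltk lti [bs sc [rp_ re_ rl_ rr_ rk_] [mt mb mf]].
have [] := next_pairP lti sc.
have ltr := stride_row ltk.
move: (bs) => [? ? ? rP_ rQ_ ? rt_ ? ? bin].
rewrite /cell_body /= rt_ rr_ rp_ re_ rl_ rP_ rQ_.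
move=> eI ec lb la.
split=> // vI eqI; split=> // vA eqA; split=> // vB eqB.
rewrite -eqI -eqA -eqB in eI ec lb la.
have ltI : vI < table_cells - i by rewrite eI; lia.
have spaceE : space = bits_addr + table_cells + stride * njobs + 1
  by rewrite /space addn1.
have bitE : bits_addr = table_addr + table_cells by [].
have bI : table_addr + vI < space by lia.
have bC : bits_addr + stride * k + vI < space by lia.
rewrite !max0n ?maxn0; split=> [|vX0 eX0]; first lia.
split=> // vX eX.
have {eX0} eX : vX =
    extend (in_wearly k <= vA) (opt k (vA - in_wearly k) vB)
           (in_ptime k * (vA - in_wearly k)).
  rewrite eX eX0 /extend => {eX eX0}.
  case: (leqP (in_wearly k)) => [le|_] /=; last by rewrite !mul0n.
  (* The early predecessor lies [in_wearly k] whole rows back in the same column, hence in a cell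
     still at stage [k]. *)
  have E : vI - in_wearly k * sumP.+1 = cell (vA - in_wearly k) vB.
    by rewrite ec /cell mulnBl -addnBAC // leq_mul2r le orbT.
  rewrite E mt ?mul1n; try lia.
  rewrite -E (_ : _ < _ = true); last lia.
  by case: posnP => [->|]; rewrite //= mul1n.
split=> [|vY0 eY0]; first by clear eX; lia.
split=> // vY eY.
have {eY0} eY : vY =
    extend (in_ptime k <= vB) (opt k vA (vB - in_ptime k))
           (in_wlate k * vB).
  rewrite eY eY0 /extend => {eX eY eY0}.
  case: (leqP (in_ptime k)) => [le|_] /=; last by rewrite !mul0n.
  have E : vI - in_ptime k = cell vA (vB - in_ptime k).
    by rewrite ec /cell; lia.
  rewrite E mt ?mul1n; try lia.
  rewrite -E (_ : _ < _ = true); last lia.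
  by case: posnP => [->|]; rewrite //= mul1n.
split=> // vD eD.
(* The formula stored in [rD] is [prefer] computed on the values 0 and 1. *)
have {}eD : vD = opt_early k vA vB.
  rewrite /dp_early -eX -eY eD /prefer.
  by case: (posnP vX) => //=; case: (posnP vY) => //= _ _; case: leqP.
split=> // _ vT -> eT.
split=> // _ vC -> eC.
have {}eT : vT = opt k.+1 vA vB.
  rewrite eT eD /= -eX -eY /dp_early -eX -eY.
  by case: prefer; rewrite ?mul1n ?mul0n ?addn0.
clear bI bC.
split=> //.
- split=> //= a la'; rewrite !ifF ?bin //; apply/negbTE/eqP;
    move: la'; rewrite /table_addr /bits_addr /table_addr; lia.
split.
- move=> a b la' lb' /=; have := cell_lt la' lb' => ltc.
  rewrite ifF; last by apply/negbTE/eqP; lia.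
  rewrite eqn_add2l; case: eqP => [cE | ne].
    have [-> ->] := cell_inj lb' lb (etrans cE ec).
    by rewrite eT -ec (_ : _ < _ = false) //; lia.
  by rewrite mt //; congr (dp _ _ _ (if _ then _ else _)); lia.
- move=> a b la' lb' lec /=; have := cell_lt la' lb' => ltc.
  rewrite eqn_add2l; case: eqP => [cE | ne].
    have [-> ->] := cell_inj lb' lb (etrans cE ec).
    by rewrite eC eD.
  rewrite ifF; last by apply/negbTE/eqP; lia.
  by rewrite mb //; lia.
- move=> x hx /=; rewrite !ifF ?mf //; apply/negbTE/eqP; lia.
Qed.

(** * The forward pass over the jobs *)

Definition job_time : nat :=
  line_time job_head + ((table_cells.+1 * ((expr_time $rI).+1 + line_time cell_body)) +
  line_time (rK ::= $rK + `1)%ram).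

(** With stride 0 every job overwrites the same row of bits, so the guard on [j] leaves only the
    last processed job. *)
Definition job_inv lim (st0 : state) k (st : state) : Prop :=
  [/\ base st, reg st rK = k /\ reg st rLim = lim, table k st,
      forall j, j < k -> (stride = 0 -> j.+1 = k) -> bits j st &
      forall x, x < table_addr -> mem st x = mem st0 x].

Lemma job_step lim st0 k st : k < njobs -> job_inv lim st0 k st ->
  runs job_body st job_time space (job_inv lim st0 k.+1).
Proof.
move=> ltk [bs [rk_ rlim_] tb bt mf].
have spaceE : space = 5 * njobs + 1 + table_cells + table_cells + stride * njobs + 1
  by rewrite /space addn1.
apply: runs_seq.
apply: (runs_weaken (leqnn _) (Q := fun st1 =>
  cell_inv k st 0 st1 /\ reg st1 rLim = lim)); last first.
  apply: runs_wp.
  move: (bs) => [? rN_ rW_ rP_ rQ_ rT_ rt_ rb_ rs_ bin].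
  rewrite /job_head /= rN_ rk_ rW_ rT_ rb_ rs_ ?max0n ?maxn0.
  split=> [|_ ->]; first lia.
  split=> [|_ ->]; first lia.
  split=> [|_ ->]; first lia.
  split=> // _ ->. split=> // _ ->. split=> // _ ->. split=> // _ ->.
  split; last by [].
  split.
  - by split.
  - by rewrite /scanning /= subn0 /cell /table_cells addn0 addn1.
  - split=> //=; rewrite bin //; lia.
  - rewrite subn0; split=> //=.
    + by move=> a b la lb; rewrite cell_lt // tb.
    + by move=> a b la lb; rewrite leqNgt cell_lt.
move=> st1 [inv1 rlim1]; apply: runs_seq.
apply: (runs_weaken (leqnn _) (Q := fun st2 =>
  cell_inv k st table_cells st2 /\ keeps cell_body st1 st2)); last first.
  apply: runs_keeps; apply: runs_while inv1.
  - move=> i st2 lti inv2; split=> //.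
      by case: inv2 => _ [/= -> _ _ _] _ _; rewrite subn_eq0 -ltnNge.
    by apply: runs_wp; apply: cell_step.
  - by move=> st2 [_ [/= -> _ _ _] _ _]; rewrite subnn.
move=> st2 [[bs2 _ [_ _ _ _ rk2] [mt2 mb2 mf2]] kp2].
apply: runs_wp; rewrite /= rk2; split=> // _ ->.
split=> /=.
- by case: bs2.
- by rewrite addn1 kp2.
- by move=> a b la lb; rewrite mt2 // subnn.
- move=> j; rewrite addn1 ltnS leq_eqVlt => /predU1P[-> _ a b la lb | ltj s0 a b la lb].
    by rewrite /= mb2 // subnn.
  rewrite /= mf2; first by rewrite bt // => /s0; lia.
  (* With full stride, row [j] ends before row [k] begins; with stride 0 the guard contradicts
     [j < k]. *)
  have := cell_lt la lb; move: s0; rewrite /stride; case: full => /= s0.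
    by rewrite !mul1n => ltc; right; nia.
  by have := s0 (mul0n _); lia.
- by move=> x hx /=; rewrite mf2 ?mf //; left.
Qed.

Definition forward_time (lim : nat) : nat :=
  line_time (rI ::= `0)%ram +
  (table_cells.+1 * ((expr_time ($rI + `1 <= $rT)%ram).+1 + line_time clear_body) +
  (line_time ($rTab ::~ `1 ;; rK ::= `0)%ram +
   lim.+1 * ((expr_time ($rK + `1 <= $rLim)%ram).+1 + job_time))).

Lemma forwardP lim st : lim <= njobs -> base st -> reg st rLim = lim ->
  runs forward st (forward_time lim) space (job_inv lim st lim).
Proof.
move=> lel bs rl0.
have spaceE : space = table_addr + table_cells + table_cells + stride * njobs + 1
  by rewrite /space addn1.
pose cinv i st1 := [/\ base st1, reg st1 rI = i /\ reg st1 rLim = lim,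
  forall x, x < i -> mem st1 (table_addr + x) = 0 &
  forall x, x < table_addr -> mem st1 x = mem st x].
apply: runs_seq; apply: runs_wp; split=> // _ ->.
apply: runs_seq.
apply: (runs_weaken (leqnn _) (Q := cinv table_cells)); last first.
  apply: runs_while; last by split=> //; case: bs.
  - move=> i st1 lti [bs1 [ri1 rl1] c1 mf1].
    move: (bs1) => [? ? ? ? ? rT_ rt_ ? ? bin].
    split; [by rewrite /= ri1 rT_ addn1 lti | by [] |].
    apply: runs_wp; rewrite /= ri1 rt_ addn1; split=> //; first lia.
    move=> _ _ -> ->; split=> // _ ->; split=> //=.
    + split=> //= a la; rewrite ifF ?bin //; apply/negbTE/eqP; rewrite /table_addr; lia.
    + by move=> x; rewrite ltnS leq_eqVlt eqn_add2l; case: eqP => //= _; apply: c1.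
    + move=> x hx; rewrite ifF ?mf1 //; apply/negbTE/eqP; lia.
  - move=> st1 [bs1 [ri1 _] _ _]; split=> //.
    by rewrite /= ri1 (baseT bs1) addn1 ltnn.
move=> st1 [bs1 [_ rl1] c1 mf1].
apply: runs_seq; apply: runs_wp.
move: (bs1) => [? ? ? ? ? rT_ rt_ ? ? bin].
rewrite /= rt_; split=> //; first lia.
move=> _ _ -> ->; split=> // _ ->.
apply: runs_while.
- move=> i st2 lti inv2; case: (inv2) => _ [rk2 rl2] _ _ _; split=> //.
    by rewrite /= rk2 rl2 addn1 lti.
  by apply: job_step => //; apply: leq_trans lel.
- by move=> st2 [_ [rk2 rl2] _ _ _]; rewrite /= rk2 rl2 addn1 ltnn.
split=> //=.
- split=> //= a la; rewrite ifF ?bin //; apply/negbTE/eqP; rewrite /table_addr; lia.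
(* The first cell is that of the pair (0, 0), and its content 1 encodes cost 0; all cleared cells
   encode unreachable states. *)
- move=> a b la lb; have ltc := cell_lt la lb; rewrite [LHS]/=.
  have -> : (table_addr + cell a b == table_addr) = (a == 0) && (b == 0).
    by rewrite -{2}[table_addr]addn0 eqn_add2l addn_eq0 muln_eq0 orbF.
  by rewrite /=; case: (_ && _) => //; apply: c1.
- move=> x hx; rewrite ifF ?mf1 //; apply/negbTE/eqP; lia.
Qed.

(** * Search for the cheapest terminal state *)

Definition least_from i (st : state) : Prop :=
  (0 < reg st rV -> exists a b, [/\ a <= sumE, b <= sumP,
     reg st rV = opt njobs a b,
     reg st rCur = cell a b & reg st rTardy = b]) /\
  (forall a b, a <= sumE -> b <= sumP -> i <= cell a b ->
     0 < opt njobs a b -> 0 < reg st rV <= opt njobs a b).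

Definition min_inv (st0 : state) i (st : state) : Prop :=
  [/\ base st, scanning i st, forall x, mem st x = mem st0 x
    & least_from (table_cells - i) st].

(** The value 0 of [rV] plays infinity until a reachable terminal state is met. *)
Lemma min_step st0 i st : table njobs st0 -> i < table_cells -> min_inv st0 i st ->
  wp space min_body st (min_inv st0 i.+1).
Proof.
move=> tb lti [bs sc mf [ex lo]].
have [] := next_pairP lti sc.
have spaceE : space = table_addr + table_cells + table_cells + stride * njobs + 1
  by rewrite /space addn1.
move: (bs) => [? ? ? rP_ ? ? rt_ ? ? bin].
rewrite /min_body /= rt_ rP_.
move=> eI ec lb la.
split=> // vI eqI; split=> // vA eqA; split=> // vB eqB.
rewrite -eqI -eqA -eqB in eI ec lb la.
have ltI : vI < table_cells - i by rewrite eI; lia.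
rewrite ?max0n ?maxn0; split=> [|_ ->]; first lia.
rewrite mf ec tb //; split=> //.
have sc' : forall st', reg st' rI = cell vA vB -> reg st' rA = vA ->
    reg st' rB = vB -> scanning i.+1 st'.
  by move=> st' h1 h2 h3; split; rewrite ?h1 ?h2 ?h3 // -ec.
have split_le a b : a <= sumE -> b <= sumP -> table_cells - i.+1 <= cell a b ->
    (a = vA /\ b = vB) \/ table_cells - i <= cell a b.
  move=> la' lb'; rewrite -eI leq_eqVlt => /predU1P[E|]; last by right; lia.
  by left; apply: cell_inj; rewrite // -E.
set d := dp _ _ _ _ vA vB.
rewrite (_ : (_ != 0) = (0 < d) && ((reg st rV == 0) || (d <= reg st rV))).
  case: ifP => [/andP[d0 hd] | hd].
    split=> // _ ->; split=> // _ ->; split=> // _ ->; split=> //.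
    - exact: sc'.
    - split=> /= [_|a b la' lb' hc]; first by exists vA, vB.
      case: (split_le a b la' lb' hc) => [[-> ->] | hc'] hd'; first by rewrite d0 /=.
      by have := lo _ _ la' lb' hc' hd'; rewrite d0; lia.
  split=> //.
  - exact: sc'.
  - split=> //= a b la' lb' hc.
    case: (split_le a b la' lb' hc) => [[-> ->] | hc']; last exact: lo.
    by rewrite -/d => d0; move: hd; rewrite d0 /=; lia.
case: (posnP d) => //= _; case: (posnP (reg st rV)) => //= h.
by rewrite subnn mul1n add0n; case: leqP.
Qed.

Definition min_time : nat :=
  line_time (start_scan ;; rV ::= `0)%ram +
  table_cells.+1 * ((expr_time $rI).+1 + line_time min_body).

Lemma find_minP st : base st -> table njobs st ->
  runs find_min st min_time space (fun st' =>
    [/\ base st', forall x, mem st' x = mem st x & least_from 0 st']).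
Proof.
move=> bs tb; apply: runs_seq; apply: runs_wp.
move: (bs) => [? ? rW_ ? ? rT_ ? ? ? ?].
rewrite /start_scan /= rT_ rW_.
split=> // _ ->; split=> // _ ->; split=> // _ ->; split=> // _ ->.
apply: (runs_weaken (leqnn _) (Q := min_inv st table_cells)).
  by move=> st' [? _ ?]; rewrite subnn.
apply: runs_while.
- move=> i st2 lti inv2; split=> //.
    by case: inv2 => _ [/= -> _ _ _] _ _; rewrite subn_eq0 -ltnNge.
  by apply: runs_wp; apply: min_step.
- by move=> st2 [_ [/= -> _ _ _] _ _]; rewrite subnn.
split=> //.
- by split; rewrite //= ?subn0 // /cell /table_cells addn0 addn1.
- split=> //= a b la lb; by rewrite subn0 leqNgt cell_lt.
Qed.

(** * Tracing the decisions back *)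

Section Trace.
Variable ear : nat -> bool.

Notation sa := (sumif in_wearly ear).
Notation sb := (sumif in_ptime (fun i => ~~ ear i)).

(** The due date is [sumP], so an early block that ends there starts at the total tardy length
    [sb njobs]. *)
Definition start_of (j : nat) : nat :=
  if ear j then sb njobs + sumif in_ptime ear j else sumP + sb j.

Hypothesis ear_dp : traces in_ptime in_wearly in_wlate ear njobs.

(** The registers describe the state reached before the last [i] jobs. Bits are assumed only for
    [full], since otherwise each round recomputes those it reads. *)
Definition trace_inv i (st : state) : Prop :=
  let j := njobs - i in
  [/\ base st, full -> forall k, k < njobs -> bits k st,
      [/\ reg st rJ = j, reg st rCur = cell (sa j) (sb j), reg st rTardy = sb j,
          reg st rPre = \sum_(i < j) in_ptime i & reg st rLast = sb njobs] &
      forall k, j <= k < njobs -> mem st (3 * njobs + 1 + k) = ear k /\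
        mem st (3 * njobs + 1 + njobs + k) = start_of k].

Definition trace_step_time : nat :=
  line_time (rJ ::= $rJ - `1)%ram +
  ((if full then 0 else line_time (rLim ::= $rJ + `1)%ram + forward_time njobs) +
   line_time trace_read).

Lemma trace_step i st : i < njobs -> trace_inv i st ->
  runs (trace_body full) st trace_step_time space (trace_inv i.+1).
Proof.
move=> lti [bs bt [rj_ rc_ rt_ rp_ rl_] mo].
have spaceE : space = table_addr + table_cells + table_cells + stride * njobs + 1
  by rewrite /space addn1.
have table_addrE : table_addr = 5 * njobs + 1 by [].
have jE : njobs - i = (njobs - i.+1).+1 by lia.
have ltj : njobs - i.+1 < njobs by lia.
rewrite jE in rj_ rc_ rt_ rp_ mo; rewrite /trace_inv.
move: (njobs - i.+1) rj_ rc_ rt_ rp_ mo ltj => j rj_ rc_ rt_ rp_ mo ltj {jE}.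
apply: runs_seq; apply: runs_wp; split=> // _ ->.
rewrite [eval _ _]/= rj_ subn1 /=; set st1 := set_reg _ _ _.
have bs1 : base st1 by split; case: bs.
apply: runs_seq.
(* Both variants meet here: whether stored or recomputed, the bits of job [j] are available and the
   trace registers are intact. *)
apply: (runs_weaken (leqnn _) (Q := fun st2 => [/\ base st2, bits j st2,
  full -> forall k, k < njobs -> bits k st2,
  forall x, x \notin writes forward -> x != rLim -> reg st2 x = reg st1 x &
  forall x, x < table_addr -> mem st2 x = mem st1 x])).
  move=> st2 [bs2 bj2 bt2 kp2 mf2]; apply: runs_wp.
  have r24 : reg st2 rJ = j by rewrite kp2.
  have r21 : reg st2 rCur = cell (sa j.+1) (sb j.+1) by rewrite kp2 // -rc_.
  have r22 : reg st2 rTardy = sb j.+1 by rewrite kp2 // -rt_.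
  have r23 : reg st2 rLast = sb njobs by rewrite kp2 // -rl_.
  have r25 : reg st2 rPre = \sum_(i < j.+1) in_ptime i by rewrite kp2 // -rp_.
  have lsa : sa j.+1 <= sumE by apply: sumif_le.
  have lsb : sb j.+1 <= sumP by apply: sumif_le.
  have ltc := cell_lt lsa lsb.
  have ltr := stride_row ltj.
  (* The bit read at the current state is the decision [ear j], because [ear] follows the stored
     bits. *)
  have bj := bj2 _ _ lsa lsb; rewrite ear_dp // in bj.
  have bE : bits_addr = table_addr + table_cells by [].
  have mo2 : forall k, j < k < njobs -> mem st2 (3 * njobs + 1 + k) = ear k /\
        mem st2 (3 * njobs + 1 + njobs + k) = start_of k.
    by move=> k hk; rewrite !mf2; [exact: mo | lia | lia].
  have sub_p : \sum_(i < j.+1) in_ptime i - in_ptime j = \sum_(i < j) in_ptime i.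
    by rewrite big_ord_recr addnK.
  have pE : mem st2 (1 + j) = in_ptime j by rewrite (base_in bs2) //; lia.
  have eE : mem st2 (1 + njobs + j) = in_wearly j by rewrite (base_in bs2) //; lia.
  move: (bs2) => [rO_ rN_ ? rP_ rQ_ ? ? rb_ rs_ bin].
  rewrite /trace_read /= r24 r21 r23 r25 rO_ rN_ rP_ rQ_ rb_ rs_ ?max0n ?maxn0 bj pE.
  split=> [|_ ->]; first lia.
  split=> [|_ ->]; first lia.
  split=> // _ ->; rewrite sub_p.
  split=> [|||_ _ -> ->]; [lia | lia | lia |].
  have ne1 : (1 + njobs + j == 3 * njobs + 1 + j) = false by apply/eqP; lia.
  rewrite ne1 eE.
  have saS := sumifS in_wearly ear j; have sbS := sumifS in_ptime (fun i => ~~ ear i) j.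
  have spl := sumif_split in_ptime ear j.
  have curE : cell (sa j.+1) (sb j.+1) - (if ear j then in_wearly j * sumP.+1 else in_ptime j)
      = cell (sa j) (sb j).
    rewrite saS sbS /cell; case: (ear j) => /=; last by rewrite addn0; lia.
    by rewrite mulnDl; lia.
  have outE v k : v = start_of j -> j <= k < njobs ->
      (if 3 * njobs + 1 + k == 3 * njobs + 1 + njobs + j then v
       else if 3 * njobs + 1 + k == 3 * njobs + 1 + j then (ear j : nat)
       else mem st2 (3 * njobs + 1 + k)) = ear k /\
      (if 3 * njobs + 1 + njobs + k == 3 * njobs + 1 + njobs + j then v
       else if 3 * njobs + 1 + njobs + k == 3 * njobs + 1 + j then (ear j : nat)
       else mem st2 (3 * njobs + 1 + njobs + k)) = start_of k.
    move=> -> /andP[]; rewrite leq_eqVlt => /predU1P[<- _ | ltjk ltk].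
      by rewrite !eqxx; case: eqP => [?|_] //; lia.
    have [|h1 h2] := mo2 k; first by rewrite ltjk.
    by rewrite !ifF //; apply/negbTE/eqP => E; clear - E ltjk ltk ltj; lia.
  split=> //; case: ifP => ej.
  - have {}ej : ear j by case: (ear j) ej.
    rewrite ej in curE.
    rewrite /= r22 ?max0n ?maxn0; split=> [|_ ->]; first lia.
    split=> [|||_ _ -> ->]; [lia | lia | lia |].
    split.
    + by split=> //= a la; rewrite !ifF ?bin //; apply/negbTE/eqP; lia.
    + move=> fu k ltk a b la lb; rewrite /= !ifF ?bt2 //; apply/negbTE/eqP; lia.
    + by split; rewrite //= ?r22 ?sbS ?ej ?addn0.
    + move=> k; apply: outE; rewrite /start_of ej.
      (* The length of all jobs before [j] minus that of the tardy ones among them is the early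
         length before [j]; an early [j] leaves the tardy length unchanged. *)
      by rewrite -spl sbS ej addn0 addnK.
  - have {}ej : ear j = false by case: (ear j) ej.
    rewrite ej in curE.
    split=> // _ ->; split=> // _ ->.
    rewrite /= r22 ?max0n ?maxn0.
    have tarE : sb j.+1 - in_ptime j = sb j by rewrite sbS ej addnK.
    rewrite tarE.
    split=> [|||_ _ -> ->]; [lia | lia | lia |].
    split.
    + by split=> //= a la; rewrite !ifF ?bin //; apply/negbTE/eqP; lia.
    + move=> fu k ltk a b la lb; rewrite /= !ifF ?bt2 //; apply/negbTE/eqP; lia.
    + by split.
    + by move=> k; apply: outE; rewrite /start_of ej.
have -> : (1 + 1).+2 = line_time (rLim ::= $rJ + `1)%ram by [].
have [fu|/negbTE fu] := boolP full.
  by apply: runs_wp; split=> // [|_]; [exact: bt | exact: bt].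
(* A pass over the first [j.+1] jobs makes [j] the last processed one, whose bits survive for every
   stride. *)
apply: runs_seq; apply: runs_wp; split=> // _ ->.
rewrite [eval _ _]/= addn1; set st1' := set_reg _ _ _.
have bs1' : base st1' by split; case: bs1.
have := forwardP ltj bs1' erefl; move/runs_keeps; apply: runs_weaken.
  rewrite /forward_time !leq_add2l leq_mul2r; apply/orP; right; lia.
move=> st2 [[bs2 _ _ bt2 mf2] kp2]; split=> //.
- by apply: bt2 => // _; rewrite /= addn1.
- by move=> x hx hl; rewrite kp2 //= (negPf hl).
Qed.
Definition trace_time : nat :=
  line_time (rLast ::= $rTardy ;; rJ ::= $rN ;; rPre ::= $rP)%ram +
  njobs.+1 * ((expr_time $rJ).+1 + trace_step_time).

Lemma traceP st : base st -> (full -> forall k, k < njobs -> bits k st) ->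
  reg st rCur = cell (sa njobs) (sb njobs) -> reg st rTardy = sb njobs ->
  runs (trace full) st trace_time space (trace_inv njobs).
Proof.
move=> bs bt rc_ rt_; apply: runs_seq; apply: runs_wp.
split=> // _ ->; split=> // _ ->; split=> // _ ->.
apply: runs_while.
- move=> i st1 lti inv1; split=> //; last exact: trace_step.
  by case: inv1 => _ _ [/= -> _ _ _ _] _; rewrite subn_eq0 -ltnNge.
- by move=> st1 [_ _ [/= -> _ _ _ _] _]; rewrite subnn.
rewrite /trace_inv subn0; split=> //=; first by split; case: bs.
- by rewrite baseN // rc_ rt_ baseP.
- by move=> k; case: ltngtP.
Qed.

End Trace.

(** * The prologue and the complete programs *)

Definition prologue_time : nat :=
  line_time (rN ::= @[`0])%ram +
  (njobs.+1 * ((expr_time ($rK + `1 <= $rN)%ram).+1 + line_time sum_body) +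
   line_time (setup full)).

Lemma prologueP : runs (prologue full) (State (fun _ => 0) m0) prologue_time space
  (fun st => base st /\ reg st rLim = njobs).
Proof.
have spaceE : space = 5 * njobs + 1 + table_cells + table_cells + stride * njobs + 1
  by rewrite /space addn1.
apply: runs_seq; apply: runs_wp; split=> [|_ ->]; first by rewrite /=; lia.
apply: runs_seq.
pose inv i st := [/\ [/\ reg st rN = njobs, reg st rK = i,
  reg st rP = \sum_(k < i) in_ptime k & reg st rW = \sum_(k < i) in_wearly k] & Defs.mem st = m0].
apply: (runs_weaken (leqnn _) (Q := inv njobs)).
  move=> st [[rN_ rK_ rP_ rW_] m_]; apply: runs_wp.
  rewrite /setup /= rN_ rP_ rW_.
  do 7 (split=> // _ ->).
  by split=> //; split; rewrite //= ?m_ // /bits_addr /table_addr /stride /table_cells ?addn1.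
apply: runs_while.
- move=> i st lti [[rN_ rK_ rP_ rW_] m_]; split=> //.
    by rewrite /= rN_ rK_ addn1 lti.
  apply: runs_wp; rewrite /= rN_ rK_ rP_ rW_ m_ ?max0n ?maxn0.
  split=> [|_ ->]; first lia.
  split=> [|_ ->]; first lia.
  split=> // _ ->.
  by split=> //; split; rewrite //= ?addn1 // big_ord_recr.
- by move=> st [[rN_ rK_ _ _] _]; rewrite /= rN_ rK_ addn1 ltnn.
by split=> //; split; rewrite //= big_ord0.
Qed.

Hypothesis some_terminal :
  exists a b, [/\ a <= sumE, b <= sumP & 0 < opt njobs a b].

Definition min_program_time : nat :=
  prologue_time + (forward_time njobs + min_time).

Lemma min_programP : runs (min_program full) (State (fun _ => 0) m0) min_program_time space
  (fun st => [/\ base st, 0 < reg st rV, least_from 0 st &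
    forall j, j < njobs -> (stride = 0 -> j.+1 = njobs) -> bits j st]).
Proof.
apply: runs_seq.
apply: runs_weaken prologueP => // st [bs rl]; apply: runs_seq.
apply: runs_weaken (forwardP (leqnn _) bs rl) => // st1 [bs1 _ tb1 bt1 _].
apply: runs_weaken (find_minP bs1 tb1) => // st2 [bs2 mf2 lf]; split=> //.
  have [a [b [la lb d0]]] := some_terminal.
  by have /andP[] := lf.2 a b la lb (leq0n _) d0.
by move=> j ltj s0 a b la lb; rewrite mf2 bt1.
Qed.

Lemma early_set_programP : exists f t,
  [/\ exec (early_set_program full) (State (fun _ => 0) m0) f t space,
      t <= min_program_time + trace_time + line_time touch_top
    & exists ear, [/\ traces in_ptime in_wearly in_wlate ear njobs,
        forall a b, a <= sumE -> b <= sumP -> 0 < opt njobs a b ->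
          opt njobs (sumif in_wearly ear njobs) (sumif in_ptime (fun i => ~~ ear i) njobs)
            <= opt njobs a b,
        reg f rOut = 3 * njobs + 1,
        forall k, k < njobs -> Defs.mem f (3 * njobs + 1 + k) = ear k /\
          Defs.mem f (3 * njobs + 1 + njobs + k) = start_of ear k &
        full -> forall k, k < njobs -> bits k f]].
Proof.
have [a0 [b0 [la0 lb0 d0]]] := some_terminal.
pose Q st := exists ear, [/\ traces in_ptime in_wearly in_wlate ear njobs,
  forall a b, a <= sumE -> b <= sumP -> 0 < opt njobs a b ->
    opt njobs (sumif in_wearly ear njobs) (sumif in_ptime (fun i => ~~ ear i) njobs)
      <= opt njobs a b & trace_inv ear njobs st].
have [f [t [m [ex le_t le_m [ear [tr lo [bs bt _ out]]]]]]] :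
    runs (min_program full ;; trace full)%ram (State (fun _ => 0) m0)
      (min_program_time + trace_time) space Q.
  apply: runs_seq; apply: runs_weaken min_programP => // st [bs v0 [ex lo] bt].
  have [a [b [la lb vE cE tE]]] := ex v0.
  have d1 : 0 < opt njobs a b by rewrite -vE.
  have [ear [tr saE sbE]] := dp_trace d1.
  have bt' : full -> forall k, k < njobs -> bits k st.
    (* The full stride is a table size, hence nonzero, and the guard on [k] is vacuous. *)
    move=> fu k ltk; apply: bt => //; rewrite /stride fu mul1n /table_cells; lia.
  rewrite -saE -sbE in cE; rewrite -sbE in tE.
  apply: runs_weaken (traceP tr bs bt' cE tE) => // st' inv; exists ear; split=> //.
  by move=> a' b' la' lb' d'; rewrite saE sbE -vE; have /andP[] := lo a' b' la' lb' (leq0n _) d'.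
have [rO_ rN_ ? ? ? rT_ ? rb_ rs_ ?] := bs.
have spaceE : eval ($rBit + $rT + $rStr * $rN)%ram f = space.-1.
  by rewrite /= rN_ rT_ rb_ rs_.
have exT := ExecStore ($rBit + $rT + $rStr * $rN)%ram (`0)%ram f.
rewrite spaceE in exT.
have := ExecSeq ex exT; rewrite -/touch_top -/(early_set_program full).
(* The run so far stays within [space], and the final store hits its top cell, so the maximum is
   [space] itself. *)
rewrite [X in exec _ _ _ _ X](_ : _ = space); last first.
  by rewrite /= !maxn0 (maxn_idPr _).
move=> exF; eexists; eexists; split; [exact: exF | by rewrite leq_add |].
rewrite subnn in out.
exists ear; split=> //.
- move=> k ltk /=; have [<- <-] := out k ltk.
  by rewrite !ifF //; apply/negbTE/eqP; rewrite /bits_addr /table_addr; lia.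
- move=> fu k ltk a b la lb /=; rewrite ifF ?bt //; apply/negbTE/eqP.
  have := cell_lt la lb; have := stride_row ltk; lia.
Qed.

End Verification.

(** * Explicit constants for the running times *)

Lemma table_cells_gt0 m0 : 0 < table_cells m0.
Proof. by []. Qed.

Lemma job_time_le m0 : job_time m0 <= 300 * table_cells m0.
Proof.
rewrite /job_time /job_head /start_scan /cell_body /next_pair.
by have := table_cells_gt0 m0; move: (table_cells m0) => t /=; lia.
Qed.

Lemma forward_time_le m0 : 0 < njobs m0 ->
  forward_time m0 (njobs m0) <= 1000 * (njobs m0 * table_cells m0).
Proof.
move=> n0; rewrite /forward_time /clear_body; have := job_time_le m0; have := table_cells_gt0 m0.
move: (table_cells m0) (job_time m0) (njobs m0) n0 => t J n n0 t0 /= leJ; nia.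
Qed.

Lemma min_time_le m0 : min_time m0 <= 200 * table_cells m0.
Proof.
rewrite /min_time /start_scan /min_body /next_pair.
by have := table_cells_gt0 m0; move: (table_cells m0) => t /=; lia.
Qed.

Lemma prologue_time_le m0 full : 0 < njobs m0 ->
  prologue_time m0 full <= 100 * njobs m0.
Proof. rewrite /prologue_time /sum_body /setup; move: (njobs m0) => n /=; lia. Qed.

Lemma min_program_time_le m0 full : 0 < njobs m0 ->
  min_program_time m0 full <= 1500 * (njobs m0 * table_cells m0).
Proof.
move=> n0; have := prologue_time_le full n0; have := min_time_le m0.
have := forward_time_le n0; have := table_cells_gt0 m0; rewrite /min_program_time.
move: (forward_time m0 (njobs m0)) (min_time m0) (prologue_time m0 full) (table_cells m0) (njobs m0) n0.
move=> F m p t n n0 t0 leF lem lep; nia.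
Qed.

(** The extra factor [njobs m0] of the rolling variant is one forward pass for each traced job. *)
Lemma trace_time_le m0 (full : bool) : 0 < njobs m0 ->
  trace_time m0 full <= 3000 * ((if full then 1 else njobs m0) * (njobs m0 * table_cells m0)).
Proof.
move=> n0; rewrite /trace_time /trace_step_time /trace_read.
have := forward_time_le n0; have := table_cells_gt0 m0.
move: (forward_time m0 (njobs m0)) (table_cells m0) (njobs m0) n0 => F t n n0 t0 leF.
by case: full => /=; nia.
Qed.

(** * Canonical schedules are optimal *)

(** For each unordered pair the right side contains at least one of the two orientations, and the
    left side contains only the cheaper one. *)
Lemma pair_sum_le n (D : pred 'I_n) (A : 'I_n -> 'I_n -> nat) (bef : rel 'I_n) :
  (forall i j : 'I_n, i < j -> A i j <= A j i) ->
  (forall i j, i != j -> bef i j || bef j i) ->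
  \sum_(i | D i) \sum_(j | D j && (i < j)) A i j <=
  \sum_(i | D i) \sum_(j | D j && bef i j) A i j.
Proof.
move=> A_le bef_total; pose B (i j : 'I_n) := if bef i j then A i j else 0.
have upper (i : 'I_n) : \sum_(j | D j && (i < j)) B i j + \sum_(j | D j && (j < i)) B i j <=
    \sum_(j | D j && bef i j) A i j.
  rewrite [leqRHS]big_mkcondr [leqRHS](bigID (fun j : 'I_n => i < j)) /= leq_add2l.
  rewrite [leqLHS]big_mkcond [leqRHS]big_mkcond leq_sum // => j _.
  by case: (D j) => //=; case: ltngtP.
apply: (@leq_trans (\sum_(i | D i)
   (\sum_(j | D j && (i < j)) B i j + \sum_(j | D j && (j < i)) B i j))); last first.
  by apply: leq_sum => i _; apply: upper.
(* Exchanging the second sum collects both orientations of a pair under its smaller index. *)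
rewrite big_split /= [X in _ + X](exchange_big_dep D) /=; last by move=> i j _ /andP[].
rewrite -big_split /= leq_sum // => i Di.
rewrite [X in _ + X](eq_bigl (fun j : 'I_n => D j && (i < j))); last by move=> j; rewrite Di.
rewrite -big_split /= leq_sum // => j /andP[_ ltij].
have := bef_total i j; rewrite /B -val_eqE neq_ltn ltij => /(_ isT).
case: (bef i j) => /=; first by rewrite leq_addr.
by move=> ->; rewrite add0n A_le.
Qed.

Section Awet.
Variables (n : nat) (I : awet n).
Implicit Types (E : {set 'I_n}) (bef : rel 'I_n).

(** The cost of a schedule without idle time whose early block ends at the due date and whose tardy
    block starts there, both blocks ordered by [bef]. *)
Definition sequencing_cost bef E : nat :=
  \sum_(i in E) \sum_(j | (j \in E) && bef i j) wearly I i * ptime I j +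
  \sum_(j | j \notin E) wlate I j * (\sum_(i | (i \notin E) && bef i j) ptime I i
                                     + ptime I j).

(** The dynamic program charges a new early job for pushing all previous ones forward; exchanging
    the double sum charges each early job for its successors instead. *)
Lemma state_costE E :
  state_cost I n E = sequencing_cost (fun i j : 'I_n => i < j) E.
Proof.
rewrite /state_cost (eq_bigl xpredT) => [|i]; last exact: ltn_ord.
rewrite (bigID (fun i => i \in E)) /=; congr (_ + _).
  rewrite [RHS](exchange_big_dep (fun j => j \in E)) /=; last by move=> i j _ /andP[].
  apply: eq_big => // j jE; rewrite jE /dp_cost /= mulnC big_distrl /=.
  by apply: eq_bigl => i; rewrite andbC.
apply: eq_bigr => j /negPf jE; rewrite jE /dp_cost /=; congr (_ * (_ + _)).
by apply: eq_bigl => i; rewrite andbC.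
Qed.

Lemma ratio_lt (a b c d : nat) : 0 < b -> 0 < d ->
  ((a%:R / b%:R : rat) < c%:R / d%:R)%R = (a * d < c * b).
Proof.
move=> b0 d0; rewrite ltr_pdivrMr ?ltr0n // mulrAC ltr_pdivlMr ?ltr0n //.
by rewrite -!natrM ltr_nat.
Qed.

(** Cross-multiplied, the ratio inequalities say that index order is the cheaper orientation of
    every early pair and of every tardy pair. The cost of a tardy job's own length does not depend
    on the order. *)
Lemma state_cost_le bef E : strictly_indexed I ->
  (forall i j, i != j -> bef i j || bef j i) ->
  state_cost I n E <= sequencing_cost bef E.
Proof.
move=> idx tot; rewrite state_costE /sequencing_cost leq_add //.
  apply: pair_sum_le => // i j /idx[]; rewrite /early_ratio ratio_lt ?ptime_gt0 //.
  by move=> /ltnW.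
have flat (b : rel 'I_n) : \sum_(j | j \notin E)
    wlate I j * (\sum_(i | (i \notin E) && b i j) ptime I i + ptime I j) =
  \sum_(i | i \notin E) \sum_(j | (j \notin E) && b i j) wlate I j * ptime I i +
  \sum_(j | j \notin E) wlate I j * ptime I j.
  under eq_bigr => j _ do rewrite mulnDr.
  rewrite big_split /=; congr (_ + _).
  rewrite [RHS](exchange_big_dep (fun j => j \notin E)) /=; last by move=> i j _ /andP[].
  apply: eq_big => // j jE; rewrite big_distrr /=.
  by apply: eq_bigl => i; rewrite jE.
rewrite !flat leq_add2r; apply: pair_sum_le => // i j /idx[_].
by rewrite /late_ratio ratio_lt ?ptime_gt0 // => /ltnW.
Qed.

(** * Lower bound for schedules in real time *)

Section Lower.
Variable R : realType.
Local Open Scope ring_scope.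
Implicit Type S : 'I_n -> R.

Notation p j := ((ptime I j)%:R : R).
Notation d := ((due_date I)%:R : R).

(** Disjointness in terms of end points. Unlike feasibility it survives every shift, even one to
    negative start times. *)
Definition separated S : Prop :=
  forall i j, i != j -> completion I S i <= S j \/ completion I S j <= S i.

Lemma p_gt0 j : 0 < p j.
Proof. by rewrite ltr0n ptime_gt0. Qed.

(** If two jobs overlapped, the later of the two starts would lie in both intervals. *)
Lemma feasible_separated S : feasible I S -> separated S.
Proof.
move=> [_ dis] i j ij.
have in_start k : S k \in `[S k, completion I S k[.
  by rewrite in_itv /= lexx ltrDl p_gt0.
have [le|lt] := leP (S i) (S j).
  left; rewrite leNgt; apply/negP => lt.
  have := dis j i; rewrite eq_sym => /(_ ij _ (in_start j)).
  by rewrite in_itv /= le lt.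
right; rewrite leNgt; apply/negP => lt'.
by have := dis i j ij _ (in_start i); rewrite in_itv /= (ltW lt) lt'.
Qed.

(** Remove the job that starts last: all others must complete before its start, which becomes the
    new upper end. *)
Lemma packing_set S (X : {set 'I_n}) lo hi : separated S -> lo <= hi ->
  (forall j, j \in X -> lo <= S j /\ completion I S j <= hi) ->
  lo + (\sum_(j in X) ptime I j)%:R <= hi.
Proof.
move=> sep; have [m] := ubnP #|X|; elim: m X hi => // m IH X hi ltm lelh inX.
have [-> | [j0 j0X]] := set_0Vmem X; first by rewrite big_set0 addr0.
have [k kX kmax] := arg_maxP S j0X.
have [lok khi] := inX k kX.
rewrite (big_setD1 k kX) /= natrD.
have lt : (#|X :\ k| < m)%N by move: ltm; rewrite (cardsD1 k X) (kX : k \in X).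
have hyp j : j \in X :\ k -> lo <= S j /\ completion I S j <= S k.
  rewrite in_setD1 => /andP[jk jX]; split; first by case: (inX j jX).
  have := kmax j jX; have [// | lek] := sep j k jk.
  by move: lek; rewrite /completion /=; have := p_gt0 k; lra.
have := IH _ _ lt lok hyp; move: khi; rewrite /completion; lra.
Qed.

Lemma packing S (D : pred 'I_n) lo hi : separated S -> lo <= hi ->
  (forall j, D j -> lo <= S j /\ completion I S j <= hi) ->
  lo + (\sum_(j | D j) ptime I j)%:R <= hi.
Proof.
move=> sep lelh inD.
have -> : (\sum_(j | D j) ptime I j = \sum_(j in [set j | D j]) ptime I j)%N.
  by apply: eq_bigl => j; rewrite inE.
by apply: (packing_set sep) => // j; rewrite inE; apply: inD.
Qed.

Definition start_before S : rel 'I_n := fun i j => S i < S j.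

Lemma start_before_total S i j : separated S -> i != j ->
  start_before S i j || start_before S j i.
Proof.
move=> sep /sep; rewrite /start_before /completion.
case: (ltgtP (S i) (S j)) => //= -> [] h.
  by have := p_gt0 i; lra.
by have := p_gt0 j; lra.
Qed.

Lemma sequencing_cost_le S E : separated S ->
  (forall j, j \in E -> completion I S j <= d) ->
  (forall j, j \notin E -> d <= S j) ->
  (sequencing_cost (start_before S) E)%:R <= cost I S.
Proof.
move=> sep early late; rewrite /cost (bigID (fun j => j \in E)) /=.
rewrite natrD lerD // natr_sum; apply: ler_sum => j jE.
  rewrite -big_distrr /= natrM.
  rewrite -[leLHS]addr0 lerD //; last by rewrite mulr_ge0 ?ler0n // le_max lexx orbT.
  rewrite ler_wpM2l ?ler0n // le_max; apply/orP; left.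
  (* The early jobs starting after [j] are packed between its completion and the due date. *)
  suff : completion I S j + (\sum_(i | (i \in E) && start_before S j i) ptime I i)%:R <= d.
    by lra.
  apply: (packing sep) => [|i /andP[iE lt]]; [exact: early | split; last exact: early].
  have := sep j i; move: lt; rewrite /start_before.
  case: (eqVneq j i) => [->|_ lt /(_ isT)[]//]; first by rewrite ltxx.
  by rewrite /completion; have := p_gt0 i; lra.
rewrite natrM -[leLHS]add0r lerD //.
  by rewrite mulr_ge0 ?ler0n // le_max lexx orbT.
rewrite ler_wpM2l ?ler0n // le_max; apply/orP; left.
(* Symmetrically, the tardy jobs starting before [j] are packed between the due date and its
   start. *)
suff : d + (\sum_(i | (i \notin E) && start_before S i j) ptime I i)%:R <= S j.
  by rewrite natrD /completion; lra.
apply: (packing sep) => [|i /andP[iE lt]]; [exact: late | split; first exact: late].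
have := sep i j; move: lt; rewrite /start_before.
case: (eqVneq i j) => [->|_ lt /(_ isT)[]//]; first by rewrite ltxx.
by rewrite /completion; have := p_gt0 j; lra.
Qed.

Definition shift_by x S : 'I_n -> R := fun j => S j + x.

Lemma shift_separated x S : separated S -> separated (shift_by x S).
Proof.
move=> sep i j /sep; rewrite /completion /shift_by.
by case=> h; [left | right]; lra.
Qed.

(* The two shifts make k start and end at the due date; between them no other
   job crosses it, so the cost is affine in the shift. *)
Lemma straddler_convex S k : separated S -> S k < d -> d < completion I S k ->
  p k * cost I S =
  (completion I S k - d) * cost I (shift_by (d - S k) S) +
  (d - S k) * cost I (shift_by (d - completion I S k) S).
Proof.
move=> sep ltk gtk; rewrite /cost !big_distrr -big_split /=; apply: eq_bigr => j _.
have pk := p_gt0 k; have pj := p_gt0 j.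
rewrite /completion /shift_by; move: ltk gtk; rewrite /completion => ltk gtk.
have max_l (x : R) : 0 <= x -> Num.max x 0 = x by move=> h; apply/max_idPl.
have max_r (x : R) : x <= 0 -> Num.max x 0 = 0 by move=> h; apply/max_idPr.
have [jk | jk] := eqVneq j k.
  subst j.
  (* The tardiness of [k] is [S k + p k - d] now, [p k] after the first shift and 0 after the
     second. *)
  rewrite (max_r (d - (S k + p k)))
    ?(max_l (S k + p k - d)); try lra.
  rewrite (max_r (d - (S k + (d - S k) + p k)))
    ?(max_l (S k + (d - S k) + p k - d)); try lra.
  rewrite (max_r (d - (S k + (d - (S k + p k)) + p k)))
    ?(max_r (S k + (d - (S k + p k)) + p k - d)); try lra; ring.
(* A job before [k] is never tardy and a job after [k] never early in all three schedules, so every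
   maximum resolves the same way. *)
case: (sep j k jk); rewrite /completion => h.
  rewrite (max_l (d - (S j + p j)))
    ?(max_r (S j + p j - d)); try lra.
  rewrite (max_l (d - (S j + (d - S k) + p j)))
    ?(max_r (S j + (d - S k) + p j - d)); try lra.
  rewrite (max_l (d - (S j + (d - (S k + p k)) + p j)))
    ?(max_r (S j + (d - (S k + p k)) + p j - d)); try lra; ring.
rewrite (max_r (d - (S j + p j)))
  ?(max_l (S j + p j - d)); try lra.
rewrite (max_r (d - (S j + (d - S k) + p j)))
  ?(max_l (S j + (d - S k) + p j - d)); try lra.
rewrite (max_r (d - (S j + (d - (S k + p k)) + p j)))
  ?(max_l (S j + (d - (S k + p k)) + p j - d)); try lra; ring.
Qed.

Lemma cost_ge_no_straddler S : strictly_indexed I -> separated S ->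
  (forall k, completion I S k <= d \/ d <= S k) ->
  exists E, (state_cost I n E)%:R <= cost I S.
Proof.
move=> idx sep nostr; exists [set j | completion I S j <= d].
apply: le_trans (sequencing_cost_le (E := [set j | completion I S j <= d]) sep _ _).
- rewrite ler_nat; apply: state_cost_le => // i j; exact: start_before_total.
- by move=> j; rewrite inE.
- by move=> j; rewrite inE => /negP hj; case: (nostr j).
Qed.

Lemma cost_ge S : strictly_indexed I -> feasible I S ->
  exists E, (state_cost I n E)%:R <= cost I S.
Proof.
move=> idx /feasible_separated sep.
have [/existsP[k /andP[ltk gtk]] | /existsPn none] :=
    boolP [exists k, (S k < d) && (d < completion I S k)]; last first.
  apply: cost_ge_no_straddler => // k; have := none k.
  by rewrite negb_and -!leNgt => /orP[]; [right | left].
have conv := straddler_convex sep ltk gtk.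
have pk := p_gt0 k; have Ck : completion I S k = S k + p k by [].
have moved x : (S k + x = d \/ completion I S k + x = d) ->
    exists E, (state_cost I n E)%:R <= cost I (shift_by x S).
  move=> hx; apply: cost_ge_no_straddler; [by [] | exact: shift_separated |].
  move=> j; rewrite /completion /shift_by; have pj := p_gt0 j.
  have [jk | jk] := eqVneq j k.
    by subst j; case: hx; rewrite ?Ck => hx; [right | left]; lra.
  by case: (sep j k jk) => h; [left | right]; case: hx => hx; move: h; rewrite /completion; lra.
have [E1 le1] := moved (d - S k) (or_introl (subrKC _ _)).
have [E2 le2] := moved (d - completion I S k) (or_intror (subrKC _ _)).
(* The weights in [conv] are positive with sum [p k], so the cheaper shift costs at most as much as
   [S]. *)
have [le12 | lt21] := leP (cost I (shift_by (d - S k) S)) (cost I (shift_by (d - completion I S k) S)).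
  exists E1; apply: le_trans le1 _; rewrite -(ler_pM2l pk) conv.
  by move: le12 gtk ltk; rewrite Ck; nra.
exists E2; apply: le_trans le2 _; rewrite -(ler_pM2l pk) conv.
by move: lt21 gtk ltk; rewrite Ck; nra.
Qed.

End Lower.

(** * Canonical schedules attain the bound *)

Section Canonical.
Hypothesis idx : strictly_indexed I.

Lemma sorted_enum (A : {set 'I_n}) : sorted (fun i j : 'I_n => i < j) (enum A).
Proof.
rewrite {1}/enum_mem; apply: sorted_filter => [i j k|]; first exact: ltn_trans.
rewrite -enumT -(@sorted_map _ _ val (fun a b => a < b)) val_enum_ord.
exact: iota_ltn_sorted.
Qed.

(** Both enumerations are in index order, which already sorts them by the respective ratio. *)
Lemma canon_seqE E : canon_seq I E = enum E ++ enum (~: E).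
Proof.
rewrite /canon_seq; congr (_ ++ _); apply: sorted_sort.
- by move=> i j k; apply: le_trans.
- apply: sub_sorted (sorted_enum E) => i j lt; exact/ltW/(idx lt).1.
- by move=> i j k ij jk; apply: le_trans jk ij.
- apply: sub_sorted (sorted_enum (~: E)) => i j lt; exact/ltW/(idx lt).2.
Qed.

Lemma take_index_sorted (s : seq 'I_n) j : sorted (fun i j : 'I_n => i < j) s ->
  j \in s -> take (index j s) s = [seq i : 'I_n <- s | i < j].
Proof.
elim: s => //= x s IH pth; rewrite inE eq_sym.
have gt := order_path_min (fun i j k : 'I_n => @ltn_trans i j k) pth.
case: (eqVneq x j) => [xj _ | ne /= js]; first subst x.
  rewrite ltnn -(@eq_in_filter _ pred0) ?filter_pred0 // => i /(allP gt) lt.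
  by apply/esym/negbTE; rewrite -leqNgt ltnW.
by rewrite (allP gt) //= IH // (path_sorted pth).
Qed.

Lemma sum_take_index (A : {set 'I_n}) (f : 'I_n -> nat) j : j \in A ->
  \sum_(i <- take (index j (enum A)) (enum A)) f i = \sum_(i in A | i < j) f i.
Proof.
move=> jA; rewrite take_index_sorted ?mem_enum ?sorted_enum //.
by rewrite big_filter big_enum_cond.
Qed.

Lemma sum_early_late E (f : 'I_n -> nat) :
  \sum_(i in E) f i + \sum_(i | i \notin E) f i = \sum_i f i.
Proof. by rewrite [RHS](bigID (fun i => i \in E)). Qed.

Lemma canon_start_in E j : j \in E -> canon_start I E j =
  \sum_(i | i \notin E) ptime I i + \sum_(i in E | i < j) ptime I i.
Proof.
move=> jE; rewrite /canon_start canon_seqE index_cat mem_enum jE take_cat.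
rewrite index_mem mem_enum jE sum_take_index //; congr (_ + _).
by rewrite /due_date /total_ptime -(sum_early_late E) addKn.
Qed.

Lemma canon_start_notin E j : j \notin E -> canon_start I E j =
  due_date I + \sum_(i | (i \notin E) && (i < j)) ptime I i.
Proof.
move=> jE; rewrite /canon_start canon_seqE index_cat mem_enum (negPf jE) take_cat.
rewrite ltnNge leq_addr /= addKn big_cat /= sum_take_index ?inE // big_enum /=.
rewrite addnA subnK; last by rewrite /due_date /total_ptime -(sum_early_late E) leq_addr.
by congr (_ + _); apply: eq_bigl => i; rewrite inE.
Qed.

Lemma canon_completion_in E j : j \in E ->
  canon_start I E j + ptime I j + \sum_(i in E | j < i) ptime I i = due_date I.
Proof.
move=> jE; rewrite canon_start_in // /due_date /total_ptime -(sum_early_late E).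
rewrite -!addnA addnC; congr (_ + _).
rewrite [RHS](bigID (fun i : 'I_n => i < j)) /=; congr (_ + _).
rewrite [RHS](bigD1 j) /=; last by rewrite jE ltnn.
congr (_ + _); apply: eq_bigl => i; rewrite -leqNgt -andbA; congr (_ && _).
by rewrite ltn_neqAle eq_sym andbC.
Qed.

Lemma canon_start_mono E (i j : 'I_n) : (i \in E) = (j \in E) -> i < j ->
  canon_start I E i + ptime I i <= canon_start I E j.
Proof.
move=> eqE ltij; have [jE|jE] := boolP (j \in E).
  rewrite !canon_start_in ?eqE // -addnA leq_add2l [leqRHS](bigD1 i) /=; last first.
    by rewrite eqE jE.
  rewrite addnC leq_add2l [leqLHS]big_mkcond [leqRHS]big_mkcond leq_sum // => k _.
  case: (k \in E) => //=; case: ltnP => //= ltki.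
  by rewrite (ltn_trans ltki ltij) -val_eqE neq_ltn ltki.
rewrite !canon_start_notin ?eqE // -addnA leq_add2l [leqRHS](bigD1 i) /=; last first.
  by rewrite eqE jE.
rewrite addnC leq_add2l [leqLHS]big_mkcond [leqRHS]big_mkcond leq_sum // => k _.
case: (k \in E) => //=; case: ltnP => //= ltki.
by rewrite (ltn_trans ltki ltij) -val_eqE neq_ltn ltki.
Qed.

Lemma canon_disjoint E (i j : 'I_n) : i != j ->
  canon_start I E i + ptime I i <= canon_start I E j \/
  canon_start I E j + ptime I j <= canon_start I E i.
Proof.
have cross (a b : 'I_n) : a \in E -> b \notin E ->
    canon_start I E a + ptime I a <= canon_start I E b.
  move=> aE bE; rewrite (canon_start_notin bE) -(canon_completion_in aE).
  by rewrite -addnA leq_addr.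
move=> ij; have [iE|iE] := boolP (i \in E); have [jE|jE] := boolP (j \in E).
- have [lt|lt|/val_inj eqij] := ltngtP i j;
    [left | right | by rewrite eqij eqxx in ij];
    by apply: canon_start_mono; rewrite // iE jE.
- by left; apply: cross.
- by right; apply: cross.
- have [lt|lt|/val_inj eqij] := ltngtP i j;
    [left | right | by rewrite eqij eqxx in ij];
    by apply: canon_start_mono; rewrite // (negPf iE) (negPf jE).
Qed.

Section Real.
Variable R : realType.
Local Open Scope ring_scope.

Lemma canon_feasible E : feasible I (@canon_schedule _ I R E).
Proof.
split=> [j | i j ij t]; first exact: ler0n.
rewrite !in_itv /= /completion /canon_schedule => /andP[le1 lt1].
apply/negP => /andP[le2 lt2].
by case: (canon_disjoint E ij); rewrite -(ler_nat R) natrD; lra.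
Qed.

(** Without idle time the packing estimates of the lower bound become equalities. *)
Lemma canon_cost E : cost I (@canon_schedule _ I R E) = (state_cost I n E)%:R.
Proof.
rewrite state_costE /cost /sequencing_cost natrD (bigID (fun i => i \in E)) /=.
rewrite [X in _ = X + _]natr_sum [X in _ = _ + X]natr_sum.
congr (_ + _); apply: eq_bigr => j jE.
  have := congr1 (fun m => m%:R : R) (canon_completion_in jE).
  rewrite -big_distrr /= natrM natrD natrD /completion /canon_schedule => E1.
  have s0 : 0 <= ((\sum_(i in E | (j < i)%N) ptime I i)%N%:R : R) by exact: ler0n.
  rewrite (max_idPl _) ?(max_idPr _); try lra.
  by rewrite mulr0 addr0; congr (_ * _); lra.
rewrite /completion /canon_schedule (canon_start_notin jE) natrM !natrD.
have s0 : 0 <= ((\sum_(i | (i \notin E) && (i < j)%N) ptime I i)%N%:R : R) by exact: ler0n.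
have p0 := p_gt0 R j.
by rewrite (max_idPr _) ?(max_idPl _); lra.
Qed.

Lemma min_state_cost_optimal E :
  (forall E', state_cost I n E <= state_cost I n E')%N ->
  optimal_schedule I (@canon_schedule _ I R E).
Proof.
move=> minE; split=> [|S' fS]; first exact: canon_feasible.
have [E' leE'] := cost_ge idx fS; apply: le_trans leE'.
by rewrite canon_cost ler_nat.
Qed.

End Real.

(** Starting from all jobs tardy, making the first job early saves its positive tardiness cost,
    costs nothing as it ends at the due date, and delays no other job. *)
Lemma min_state_cost_neq0 E : 0 < n ->
  (forall E', state_cost I n E <= state_cost I n E') -> E != set0.
Proof.
move=> n0 minE; apply/eqP => E0; pose j0 := Ordinal n0.
have := minE [set j0]; rewrite E0 !state_costE leqNgt => /negP[].
rewrite /sequencing_cost big_set1 big_set0 add0n big_pred0 => [|j]; last first.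
  by rewrite inE; case: eqVneq => // ->; rewrite ltnn.
rewrite add0n [ltnRHS](bigD1 j0) ?inE //= -[ltnLHS]add0n -addSn.
apply: leq_add.
  by rewrite muln_gt0 wlate_gt0 addn_gt0 ptime_gt0 orbT.
rewrite (eq_bigl (fun j => (j \notin set0) && (j != j0))); last first.
  by move=> j; rewrite !inE.
apply: leq_sum => j _; rewrite leq_mul2l leq_add2r; apply/orP; right.
rewrite [leqLHS]big_mkcond [leqRHS]big_mkcond leq_sum // => i _.
by rewrite !inE; case: (_ == _) => //=.
Qed.

End Canonical.

End Awet.

(** * The programs on an instance *)

Section Instance.
Variables (n : nat) (I : awet n).
Implicit Types (E : {set 'I_n}) (ear : nat -> bool).

Definition input : nat -> nat := nth 0 (input_seq I).
Notation pt := (in_ptime input).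
Notation we := (in_wearly input).
Notation wl := (in_wlate input).

Lemma nth_ord_image (f : 'I_n -> nat) (s : seq nat) (j : 'I_n) :
  nth 0 ([seq f i | i : 'I_n] ++ s) j = f j.
Proof.
by rewrite nth_cat size_map size_enum_ord ltn_ord (nth_map j) ?size_enum_ord // nth_ord_enum.
Qed.

Lemma nth_image_skip (f : 'I_n -> nat) (s : seq nat) k :
  nth 0 ([seq f i | i : 'I_n] ++ s) (n + k) = nth 0 s k.
Proof. by rewrite nth_cat size_map size_enum_ord ltnNge leq_addr addKn. Qed.

Lemma ptE (j : 'I_n) : pt j = ptime I j.
Proof. exact: nth_ord_image. Qed.

Lemma weE (j : 'I_n) : we j = wearly I j.
Proof.
rewrite /in_wearly -addnA /input /input_seq [njobs _]/= add1n /=.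
by rewrite nth_image_skip nth_ord_image.
Qed.

Lemma wlE (j : 'I_n) : wl j = wlate I j.
Proof.
rewrite /in_wlate -addnA /input /input_seq [njobs _]/= add1n /= mul2n -addnn -addnA.
by rewrite !nth_image_skip -[X in nth _ X]cats0 nth_ord_image.
Qed.

Lemma sumPE : sumP input = total_ptime I.
Proof. by apply: eq_bigr => j _; apply: ptE. Qed.

Lemma sumEE : sumE input = total_wearly I.
Proof. by apply: eq_bigr => j _; apply: weE. Qed.

Lemma table_cellsE : table_cells input = table_size I.
Proof. by rewrite /table_cells sumPE sumEE. Qed.

(** Processing times are at least 1, so [n] is at most their sum; this absorbs the cells for input
    and output into the table size. *)
Lemma jobs_le_table : n <= table_size I.
Proof.
rewrite /table_size; apply: (@leq_trans (total_ptime I)); last by rewrite mulSn; lia.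
rewrite -[leqLHS]card_ord -sum1_card.
by apply: leq_sum => j _; apply: ptime_gt0.
Qed.

Definition early_of E (k : nat) : bool :=
  if insub k is Some j then (j : 'I_n) \in E else false.

Lemma early_ofE E (j : 'I_n) : early_of E j = (j \in E).
Proof. by rewrite /early_of valK. Qed.

Section Agree.
Variables (E : {set 'I_n}) (ear : nat -> bool).
Hypothesis earE : forall j : 'I_n, ear j = (j \in E).

Lemma state_after_sumif k : k <= n ->
  state_after I k E = (sumif we ear k, sumif pt (fun i => ~~ ear i) k).
Proof.
move=> lekn; rewrite /state_after /sumif (big_ord_widen_cond _ ear _ lekn).
rewrite (big_ord_widen_cond _ (fun i => ~~ ear i) _ lekn).
by congr (_, _); apply: eq_big => i; rewrite ?weE ?ptE // earE andbC.
Qed.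

Lemma state_cost_path k : k <= n -> state_cost I k E = path_cost pt we wl ear k.
Proof.
move=> lekn; rewrite /state_cost /path_cost (big_ord_widen _ (fun j =>
  if ear j then pt j * sumif we ear j
  else wl j * (sumif pt (fun i => ~~ ear i) j + pt j)) lekn).
apply: eq_bigr => j _; rewrite state_after_sumif ?(ltnW (ltn_ord j)) // earE.
by case: (j \in E); rewrite /dp_cost /= ?ptE ?wlE.
Qed.
End Agree.

Definition least (k : nat) (s : nat * nat) : nat := dp pt we wl k s.1 s.2.

Lemma least_le E k : k <= n ->
  0 < least k (state_after I k E) <= (state_cost I k E).+1.
Proof.
move=> lekn; rewrite (state_after_sumif (early_ofE E) lekn).
rewrite (state_cost_path (early_ofE E) lekn); exact: dp_le_path_cost.
Qed.

Lemma reachable_least_gt0 k s : k <= n -> reachable I k s -> 0 < least k s.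
Proof. by move=> lekn [E <-]; case/andP: (least_le E lekn). Qed.

Lemma reachable_bounds k s : k <= n -> reachable I k s ->
  s.1 <= sumE input /\ s.2 <= sumP input.
Proof.
move=> lekn [E <-]; rewrite (state_after_sumif (early_ofE E) lekn).
by split; apply: sumif_le.
Qed.

Lemma traces_cost ear E k : k <= n -> (forall j : 'I_n, ear j = (j \in E)) ->
  traces pt we wl ear k -> least k (state_after I k E) = (state_cost I k E).+1.
Proof.
move=> lekn earE tr; rewrite (state_after_sumif earE lekn).
by rewrite (state_cost_path earE lekn); apply: dp_eq_path_cost.
Qed.

(** The traced path attains the entry and every path to [s] costs at least as much; the predecessor
    function undoes the encoding by cost plus one. *)
Lemma least_cost_least k s : k <= n -> 0 < least k s ->
  least_cost I k s (least k s).-1.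
Proof.
move=> lekn s0; have [ear [tr sa sb]] := dp_trace s0.
pose E := [set j : 'I_n | ear j].
have earE (j : 'I_n) : ear j = (j \in E) by rewrite inE.
have sE : state_after I k E = s.
  by rewrite (state_after_sumif earE lekn) sa sb -surjective_pairing.
split.
  by exists E; split=> //; rewrite -sE (traces_cost lekn earE tr).
move=> E' <-; have /andP[] := least_le E' lekn; lia.
Qed.

Lemma is_predecessor_dp_early (j : 'I_n) s : reachable I j.+1 s ->
  is_predecessor I j s (dp_early pt we wl j s.1 s.2).
Proof.
move=> rs; have ltjn := ltn_ord j; have lejn := ltnW ltjn.
have s0 := reachable_least_gt0 ltjn rs; have lc := least_cost_least ltjn s0.
move: (dp_step s0) lc; rewrite -/(least _ _); case: ifP => _ [le pos ->] lc.
  (* The previous state is found by undoing the decision, its cost by decoding its table entry. *)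
  exists (s.1 - we j, s.2), (least j (s.1 - we j, s.2)).-1; split.
  - by rewrite /dp_move /= -weE subnK // -surjective_pairing.
  - exact: least_cost_least.
  - move: lc; rewrite /dp_cost /= -ptE /least /=; move: pos.
    by case: (dp _ _ _ _ _ _).
exists (s.1, s.2 - pt j), (least j (s.1, s.2 - pt j)).-1; split.
- by rewrite /dp_move /= -ptE subnK // -surjective_pairing.
- exact: least_cost_least.
- move: lc; rewrite /dp_cost /= -ptE -wlE subnK // /least /=; move: pos.
  by case: (dp _ _ _ _ _ _).
Qed.

Lemma some_terminal : exists a b,
  [/\ a <= sumE input, b <= sumP input & 0 < dp pt we wl (njobs input) a b].
Proof.
exists (sumif we xpredT n), (sumif pt (fun i => ~~ xpredT i) n).
by split; [exact: sumif_le | exact: sumif_le | case/andP: (dp_le_path_cost pt we wl xpredT n)].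
Qed.

(** The path of [E] attains its terminal entry, which is least among the terminal entries, and each
    [E'] costs at least what its own terminal entry encodes. *)
Lemma traces_minimal ear E : (forall j : 'I_n, ear j = (j \in E)) ->
  traces pt we wl ear n ->
  (forall a b, a <= sumE input -> b <= sumP input -> 0 < dp pt we wl n a b ->
     dp pt we wl n (sumif we ear n) (sumif pt (fun i => ~~ ear i) n) <= dp pt we wl n a b) ->
  forall E', state_cost I n E <= state_cost I n E'.
Proof.
move=> earE tr lo E'; have := traces_cost (leqnn n) earE tr.
rewrite (state_after_sumif earE (leqnn n)) /least /= => cE.
have /andP[pos le] := least_le E' (leqnn n).
have [la lb] : (state_after I n E').1 <= sumE input /\ (state_after I n E').2 <= sumP input.
  by apply: (reachable_bounds (leqnn n)); exists E'.
by rewrite -ltnS -cE (leq_trans _ le) // lo.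
Qed.

Lemma start_of_canon ear E (j : 'I_n) : strictly_indexed I ->
  (forall j : 'I_n, ear j = (j \in E)) ->
  start_of input ear j = canon_start I E j.
Proof.
move=> idx earE; rewrite /start_of earE.
have late k : k <= n -> sumif pt (fun i => ~~ ear i) k =
    \sum_(i | (i \notin E) && (i < k)) ptime I i.
  move=> lekn; rewrite /sumif (big_ord_widen_cond _ (fun i => ~~ ear i) _ lekn).
  by apply: eq_big => i; rewrite ?earE // => _; rewrite ptE.
have lej := ltnW (ltn_ord j).
case: ifP => jE.
  rewrite (canon_start_in idx) // late //; congr (_ + _).
    by apply: eq_bigl => i; rewrite ltn_ord andbT.
  rewrite /sumif (big_ord_widen_cond _ ear _ lej).
  by apply: eq_big => i; rewrite ?earE // => _; rewrite ptE.
by rewrite (canon_start_notin idx) ?jE // late // sumPE.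
Qed.

End Instance.

(** * The resource bounds of the three programs *)

Section Programs.
Variables (n : nat) (I : awet n) (R : realType).
Hypotheses (n_gt0 : 0 < n) (idx : strictly_indexed I).

Notation opt := (dp (in_ptime (input I)) (in_wearly (input I)) (in_wlate (input I))).
Notation opt_early :=
  (dp_early (in_ptime (input I)) (in_wearly (input I)) (in_wlate (input I))).

Lemma value_program_correct :
  runs_within I value_program (4600 * (n * table_size I)) (4600 * table_size I)
    (fun f _ => optimal_value I ((reg f 0)%:R%R : R)).
Proof.
have [st [t [m [ex le_t le_m [bs v0 [ex_min lo] _]]]]] :=
  min_programP false (some_terminal I).
have [a [b [la lb vE _ _]]] := ex_min v0.
have d0 : 0 < opt n a b.
  by rewrite -[n]/(njobs (input I)) -vE.
have [ear [tr sa sb]] := dp_trace d0.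
pose E := [set j : 'I_n | ear j].
have earE (j : 'I_n) : ear j = (j \in E) by rewrite inE.
have minE : forall E', state_cost I n E <= state_cost I n E'.
  apply: (@traces_minimal n I ear E earE tr) => a' b' la' lb' d'.
  by rewrite sa sb -[n]/(njobs (input I)) -vE; case/andP: (lo a' b' la' lb' (leq0n _) d').
have cE := @traces_cost n I ear E n (leqnn n) earE tr.
rewrite (@state_after_sumif n I E ear earE n (leqnn n)) sa sb /least /= in cE.
exists (set_reg rOut (reg st rV - 1) st).
have := ExecSeq ex (ExecAssign rOut ($rV - `1)%ram st).
rewrite -/value_program => exF; eexists; eexists; split; first exact: exF.
- have := @min_program_time_le (input I) false n_gt0; rewrite table_cellsE -[njobs _]/n.
  have := jobs_le_table I; move: (table_size I) le_t => T /=; nia.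
(* The registers are numbered from 0 to 26. *)
- rewrite [cmd_regs _](_ : _ = 27) //= !maxn0.
  move: le_m; rewrite /space /bits_addr /table_addr /stride table_cellsE mul0n -[njobs _]/n.
  by have := jobs_le_table I; lia.
- rewrite /= vE cE subn1 /=; exists (@canon_schedule n I R E); split.
    exact: min_state_cost_optimal.
  exact: canon_cost.
Qed.

(** Of the constant 4600, the search for the minimum takes 1500 and the trace 3000; the rest covers
    [touch_top]. *)
Lemma early_set_program_run (full : bool) : exists f t E,
  [/\ exec (early_set_program full) (init_state I) f t (space (input I) full),
      t <= 4600 * ((if full then 1 else n) * (n * table_size I)),
      optimal_early_set I R E,
      outputs_early_set I E f (space (input I) full)
    & full -> (forall k, k < n -> bits (input I) full k f) /\
      forall j : 'I_n, opt_early j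
        (state_after I j.+1 E).1 (state_after I j.+1 E).2 = (j \in E)].
Proof.
have [f [t [exF le_t [ear [tr lo rO out bt]]]]] :=
  early_set_programP full (some_terminal I).
pose E := [set j : 'I_n | ear j].
have earE (j : 'I_n) : ear j = (j \in E) by rewrite inE.
have minE := @traces_minimal n I ear E earE tr lo.
exists f, t, E; split=> //.
- have := @min_program_time_le (input I) full n_gt0.
  have := @trace_time_le (input I) full n_gt0; rewrite table_cellsE -[njobs _]/n.
  have := jobs_le_table I; move: le_t; rewrite [line_time _](_ : _ = 9) //.
  move: (table_size I) (min_program_time _ _) (trace_time _ _) n_gt0 => T t1 t2.
  by case: (full) => /= *; nia.
- by split; [exact: min_state_cost_neq0 minE | exact: min_state_cost_optimal].
- split; first by rewrite rO /space /bits_addr /table_addr -[njobs _]/n; lia.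
  move=> j; have [h1 h2] := out j (ltn_ord j).
  by rewrite rO h1 h2 earE (@start_of_canon n I ear E j idx earE).
- move=> fu; split; first exact: bt.
  by move=> j; rewrite (@state_after_sumif n I E ear earE) //= -earE; apply: tr.
Qed.

Lemma rolling_program_correct :
  runs_within I (early_set_program false)
    (4600 * (n * (n * table_size I))) (4600 * table_size I)
    (fun f m => exists E : {set 'I_n},
       optimal_early_set I R E /\ outputs_early_set I E f m).
Proof.
have [f [t [E [exF le_t opt out _]]]] := early_set_program_run false.
exists f, t, (space (input I) false); split=> //; last by exists E.
rewrite [cmd_regs _](_ : _ = 27) // /space /bits_addr /table_addr /stride table_cellsE mul0n.
by rewrite -[njobs _]/n; have := jobs_le_table I; lia.
Qed.

(** The address of a bit in the full layout, as a function of [n] and the two sums only, so that it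
    can be fixed before the instance. *)
Definition predecessor_cell (n W P j : nat) (s : nat * nat) : nat :=
  5 * n + 1 + W.+1 * P.+1 + W.+1 * P.+1 * j + (s.1 * P.+1 + s.2).

Lemma predecessor_cellE j s :
  predecessor_cell n (total_wearly I) (total_ptime I) j s =
  bits_addr (input I) + stride (input I) true * j + cell (input I) s.1 s.2.
Proof.
by rewrite /bits_addr /table_addr /stride mul1n /table_cells /cell sumEE sumPE.
Qed.

(** Reachable states stay inside the table, so division by its size returns the job as quotient and
    the cell as remainder. *)
Lemma predecessor_cell_inj (i j : 'I_n) s s' :
  reachable I i.+1 s -> reachable I j.+1 s' ->
  predecessor_cell n (total_wearly I) (total_ptime I) i s =
  predecessor_cell n (total_wearly I) (total_ptime I) j s' -> i = j /\ s = s'.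
Proof.
move=> /(reachable_bounds (ltn_ord i))[la lb] /(reachable_bounds (ltn_ord j))[la' lb'].
rewrite !predecessor_cellE -!(addnA (bits_addr _)) => /eqP; rewrite eqn_add2l => /eqP.
have -> : stride (input I) true = table_cells (input I) by exact: mul1n.
rewrite ![_ * nat_of_ord _]mulnC.
have lt := cell_lt la lb; have lt' := cell_lt la' lb'; move=> E.
have ij : i = j.
  apply/val_inj; have := congr1 (fun x => x %/ table_cells (input I)) E.
  by rewrite !divnMDl // !divn_small // !addn0.
split=> //; move: E; rewrite ij => /eqP; rewrite eqn_add2l => /eqP /(cell_inj lb lb')[].
by case: s {la lb lt} => a b; case: s' {la' lb' lt'} => a' b' /= -> ->.
Qed.

Lemma predecessor_program_correct :
  runs_within I (early_set_program true)
    (4600 * (n * table_size I)) (4600 * (n * table_size I))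
    (fun f m => exists E : {set 'I_n},
       [/\ optimal_early_set I R E, outputs_early_set I E f m
         & traced_from_predecessors I
             (predecessor_cell n (total_wearly I) (total_ptime I)) E f m]).
Proof.
have [f [t [E [exF le_t opt out /(_ isT)[bt tr]]]]]  := early_set_program_run true.
rewrite -[X in X * (n * _)]/1 mul1n in le_t.
exists f, t, (space (input I) true); split=> //.
  rewrite [cmd_regs _](_ : _ = 27) // /space /bits_addr /table_addr /stride table_cellsE mul1n.
  by rewrite -[njobs _]/n; have := jobs_le_table I; move: (table_size I) n_gt0 => T; nia.
exists E; split=> //; split=> [j s rs | i j s s' | j].
- have [la lb] := reachable_bounds (ltn_ord j) rs; rewrite predecessor_cellE; split.
    have := cell_lt la lb; have := @stride_row (input I) true j (ltn_ord j).
    by rewrite /space; lia.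
  exists (opt_early j s.1 s.2).
    exact: bt (ltn_ord j) _ _ la lb.
  exact: is_predecessor_dp_early.
- exact: predecessor_cell_inj.
- have rs : reachable I j.+1 (state_after I j.+1 E) by exists E.
  have [la lb] := reachable_bounds (ltn_ord j) rs.
  by rewrite predecessor_cellE (bt j (ltn_ord j) _ _ la lb) tr.
Qed.

End Programs.

Theorem mainTheorem4 (R : realType) :
  [/\ (* optimal value, rolling memory *)
      exists (c : cmd) (K : nat),
        forall (n : nat) (I : awet n), 0 < n -> strictly_indexed I ->
          runs_within I c (K * (n * table_size I)) (K * table_size I)
            (fun f _ => optimal_value I ((reg f 0)%:R%R : R)),
      (* recovery from one stored predecessor per reachable state *)
      exists (c : cmd) (K : nat)
             (addr : nat -> nat -> nat -> nat -> nat * nat -> nat),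
        forall (n : nat) (I : awet n), 0 < n -> strictly_indexed I ->
          runs_within I c (K * (n * table_size I)) (K * (n * table_size I))
            (fun f m => exists E : {set 'I_n},
               [/\ optimal_early_set I R E, outputs_early_set I E f m
                 & traced_from_predecessors I
                     (addr n (total_wearly I) (total_ptime I)) E f m])
    & (* recovery by recomputation, rolling memory *)
      exists (c : cmd) (K : nat),
        forall (n : nat) (I : awet n), 0 < n -> strictly_indexed I ->
          runs_within I c (K * (n * (n * table_size I))) (K * table_size I)
            (fun f m => exists E : {set 'I_n},
               optimal_early_set I R E /\ outputs_early_set I E f m)].
Proof.
split.
- by exists value_program, 4600 => n I; apply: value_program_correct.
- by exists (early_set_program true), 4600, predecessor_cell => n I;
    apply: predecessor_program_correct.
- by exists (early_set_program false), 4600 => n I; apply: rolling_program_correct.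
Qed.
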